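(* For every real $p\in(1,2]$ there exist a constant $c_p\in(0,2)$ and a sequence $\eta_n\to 0$ (as $n\to\infty$), both depending only on $p$, such that for every $n\in\mathbb{N}$ and every integer vector $\mathbf{k}=(k_1,\dots,k_{m+1})$ with $0=k_1<k_2<\cdots<k_{m+1}=n$, $$\Delta_{p,\mathbf{k}}(n)\ \ge\ (1+\eta_n)\,\frac{\log(2/c_p)\cdot n}{2^n}.$$
   Context: Throughout, $\log$ is the natural logarithm. Let $n\in\mathbb{N}$, $p\ge 1$ real, and $\mathbf{k}=(k_1,\dots,k_{m+1})$ integers with $0=k_1<k_2<\cdots<k_{m+1}=n$. For $\mathbf{x}=(x_1,\dots,x_n)\in\mathbb{R}^n$ put $\mathbf{x}_j=(x_{k_j+1},x_{k_j+2},\dots,x_{k_{j+1}})$ for $j=1,\dots,m$, and define $\|\mathbf{x}\|_{p,\mathbf{k},n}=\big(\sum_{j=1}^m\|\mathbf{x}_j\|_2^p\big)^{1/p}$, where $\|\cdot\|_2$ is the Euclidean norm; this is a norm on $\mathbb{R}^n$. Let $d(\mathbf{x},\mathbf{y})=\|\mathbf{y}-\mathbf{x}\|_{p,\mathbf{k},n}$. The superball of radius $r$ and center $\mathbf{x}$ is $B^n_{p,\mathbf{k}}(\mathbf{x},r)=\{\mathbf{y}\in\mathbb{R}^n: d(\mathbf{x},\mathbf{y})\le r\}$, and $B^n_{p,\mathbf{k}}(r)=B^n_{p,\mathbf{k}}(\mathbf{0},r)$. Let $r_{p,\mathbf{k},n}$ be the radius for which $\mathrm{vol}(B^n_{p,\mathbf{k}}(r_{p,\mathbf{k},n}))=1$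 (so $\mathrm{vol}(B^n_{p,\mathbf{k}}(r))=(r/r_{p,\mathbf{k},n})^n$). The maximum translative packing density is $$\Delta_{p,\mathbf{k}}(n)=\limsup_{R\to\infty}\sup_{\mathcal{P}}\frac{\mathrm{vol}\big(B^n_{p,\mathbf{k}}(R)\cap\bigcup_{\mathbf{x}\in\mathcal{P}}B^n_{p,\mathbf{k}}(\mathbf{x},r_{p,\mathbf{k},n})\big)}{\mathrm{vol}(B^n_{p,\mathbf{k}}(R))},$$ the supremum being over all $\mathcal{P}\subseteq\mathbb{R}^n$ such that the superballs $B^n_{p,\mathbf{k}}(\mathbf{x},r_{p,\mathbf{k},n})$, $\mathbf{x}\in\mathcal{P}$, have pairwise disjoint interiors. *)

(* Defs.v *)
From HB Require Import structures.
From mathcomp Require Import all_boot all_order all_algebra.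
From mathcomp Require Import all_classical all_reals all_analysis.
Set Implicit Arguments. Unset Strict Implicit. Unset Printing Implicit Defensive.
Import Order.TTheory GRing.Theory Num.Theory.
Import numFieldTopology.Exports.
Local Open Scope classical_set_scope.
Local Open Scope ring_scope.

Section Superball.
Variable R : realType.

(* The block vector k = (k_1,...,k_{m+1}) is encoded 0-based as k : nat -> nat
   with k_{j+1} = k j for j = 0..m.  Condition: 0 = k_1 < ... < k_{m+1} = n. *)
Definition admissible (n m : nat) (k : nat -> nat) : Prop :=
  k 0%N = 0%N /\ k m = n /\ (forall j, (j < m)%N -> (k j < k j.+1)%N).

Definition supnorm (p : R) (n m : nat) (k : nat -> nat) (x : 'I_n -> R) : R :=
  (\sum_(j < m)
      (Num.sqrt (\sum_(i < n | (k j <= i < k j.+1)%N) x i ^+ 2)) `^ p) `^ p^-1.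

Definition superball (p : R) (n m : nat) (k : nat -> nat) (x : 'I_n -> R) (r : R)
  : set ('I_n -> R) :=
  [set y | supnorm p m k (fun i => y i - x i) <= r].

Definition origin (n : nat) : 'I_n -> R := fun _ => 0.

Definition box (n : nat) (a b : 'I_n -> R) : set ('I_n -> R) :=
  [set y | forall i, a i <= y i <= b i].

Definition vol (n : nat) (A : set ('I_n -> R)) : \bar R :=
  ereal_inf [set s : \bar R | exists (a b : nat -> 'I_n -> R),
     (forall j i, a j i <= b j i) /\ A `<=` \bigcup_j box (a j) (b j) /\
     s = (\sum_(0 <= j <oo) (\prod_(i < n) (b j i - a j i))%:E)%E].

(* r_{p,k,n}: the radius of the superball (centred at 0) of volume 1, i.e. the
   supremum of the radii r >= 0 with vol(B(0,r)) <= 1. *)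
Definition rad (p : R) (n m : nat) (k : nat -> nat) : R :=
  sup [set r : R | 0 <= r /\ (vol (superball p m k (@origin n) r) <= 1)%E].

(* P is a packing: the superballs of radius r_{p,k,n} centred at the points of P
   have pairwise disjoint interiors (interior in the standard = product topology of R^n). *)
Definition is_packing (p : R) (n m : nat) (k : nat -> nat) (P : set ('I_n -> R)) :=
  forall x y, P x -> P y -> x <> y ->
    @interior {ptws 'I_n -> R} (superball p m k x (rad p n m k)) `&`
    @interior {ptws 'I_n -> R} (superball p m k y (rad p n m k)) = set0.

Definition local_density (p : R) (n m : nat) (k : nat -> nat) (Rr : R) : \bar R :=
  ereal_sup [set d : \bar R | exists P, is_packing p m k P /\
     d = ((fine (vol (superball p m k (@origin n) Rr `&`
                      \bigcup_(x in P) superball p m k x (rad p n m k))))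
          / fine (vol (superball p m k (@origin n) Rr)))%:E].

(* Delta_{p,k}(n) = limsup_{Rr -> oo} local_density Rr
                  = inf_M sup_{Rr >= M} local_density Rr *)
Definition Delta (p : R) (n m : nat) (k : nat -> nat) : \bar R :=
  ereal_inf [set s : \bar R | exists M : R,
     s = ereal_sup [set local_density p n m k Rr | Rr in [set Rr : R | M <= Rr]]].

End Superball.

(* Main.v *)
(* Following the hard-core model approach to dense packings.  Scale so that the
   superball radius rho is large and let the vertices of a graph be the integer
   points of a large superball, two of them adjacent when their distance is at
   most 2 rho.  Independent sets are packings, and the degrees are at most
   D ~ vol B(2 rho).  If u is adjacent to the origin, uniform convexity of the
   norm (uniformly in n and k, as 1 < p <= 2) puts all w with |w| <= |u| and
   |w - u| <= 2 rho in a superball of radius 2 (1 - eta) rho, so neighbourhoods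
   are sparse: they span average degree K at most ~ 2 (1 - eta)^n D.  A random
   independent set drawn with weight lambda^|I|, lambda ~ 1/K, then has expected
   size at least of order (#vertices / D) log (D / K), a gain of order n over the
   trivial bound 2^-n. *)
Require Import Defs.
From HB Require Import structures.
From mathcomp Require Import all_boot all_order all_algebra.
From mathcomp Require Import all_classical all_reals all_analysis.
From mathcomp Require Import ring lra.
Set Implicit Arguments. Unset Strict Implicit. Unset Printing Implicit Defensive.
Import Order.TTheory GRing.Theory Num.Theory.
Import numFieldTopology.Exports.
Local Open Scope classical_set_scope.
Local Open Scope ring_scope.

(** * Independent sets in locally sparse graphs *)

(** Sparseness comes from an ordering: an edge inside the neighbourhood of v is charged to its
    endpoint farther from v, so only neighbours w of u with |w| <= |u| have to be counted, and
    convexity shrinks exactly that part. The random set is studied conditionally on its part outside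
    the closed neighbourhood of v. Either many neighbours of v stay available and many of them are
    expected in the set, or few do and v itself is chosen with sizeable probability. Since [vol] is
    an outer measure given by countable box covers, volumes are compared with counts of integer
    points, and disjointness is exploited on finite sets of such points. The price is an error
    delta, the norm of (1,...,1), in every radius. It may depend on n and k, but with rho at least 5
    n delta all n-th powers of radii change by bounded factors only, and the gain eta depends on p
    alone. *)

Section HardCore.
Import fintype mathcomp.boot.finset.
Variables (R : realType) (T : finType) (e : rel T) (lam : R).
Hypotheses (e_sym : symmetric e) (e_irr : irreflexive e).
Hypotheses (lam_ge0 : 0 <= lam).

Definition independent (A : {set T}) :=
  [forall x in A, forall y in A, ~~ e x y].

Definition partition_fun (S : {set T}) : R :=
  \sum_(A : {set T} | independent A && (A \subset S)) lam ^+ #|A|.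

Definition closed_nbhd (u : T) : {set T} := [set w | (w == u) || e u w].

Local Notation Z := partition_fun.
Local Notation N := closed_nbhd.

Lemma independentP (A : {set T}) :
  reflect {in A &, forall x y, ~~ e x y} (independent A).
Proof.
apply: (iffP forall_inP) => [h x y xA yA|h x xA].
  by move/forall_inP: (h x xA); exact.
by apply/forall_inP => y yA; exact: h.
Qed.

Lemma independentS (A B : {set T}) : A \subset B -> independent B -> independent A.
Proof.
move=> /subsetP AB /independentP h; apply/independentP => x y /AB xB /AB yB.
exact: h.
Qed.

Lemma partition_funS (S S' : {set T}) : S \subset S' -> Z S <= Z S'.
Proof.
move=> SS'; rewrite [leRHS](bigID (fun A : {set T} => A \subset S)) /=.
rewrite -[leLHS]addr0 lerD //; last by apply: sumr_ge0 => A _; exact: exprn_ge0.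
rewrite le_eqVlt; apply/orP; left; apply/eqP; apply: eq_bigl => A.
rewrite -andbA; congr andb; rewrite andb_idl // => AS; exact: subset_trans SS'.
Qed.

Lemma partition_fun_ge1 (S : {set T}) : 1 <= Z S.
Proof.
rewrite /partition_fun (bigD1 set0) /=; last first.
  by rewrite sub0set andbT; apply/independentP => x y; rewrite inE.
by rewrite cards0 expr0 lerDl; apply: sumr_ge0 => A _; exact: exprn_ge0.
Qed.

Lemma partition_fun_ge0 (S : {set T}) : 0 <= Z S.
Proof. exact: le_trans ler01 (partition_fun_ge1 S). Qed.

(** Removing u is a bijection from the independent sets containing u to those avoiding its closed
    neighbourhood. *)
Lemma sum_independent_mem (S : {set T}) (u : T) : u \in S ->
  \sum_(A : {set T} | independent A && (A \subset S) && (u \in A)) lam ^+ #|A|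
  = lam * Z (S :\: N u).
Proof.
move=> uS; rewrite /partition_fun mulr_sumr.
rewrite (reindex_onto (fun A : {set T} => u |: A) (fun A => A :\ u)) /=; last first.
  by move=> A /andP[_ uA]; rewrite setD1K.
have E (A : {set T}) : independent (u |: A) && (u |: A \subset S) &&
   (u \in u |: A) && ((u |: A) :\ u == A) =
   (independent A && (A \subset S :\: N u)).
  rewrite setU11 andbT; apply/idP/idP.
    move=> /andP[/andP[iA uAS] /eqP uAA].
    have uA : u \notin A by rewrite -uAA !inE eqxx.
    rewrite (independentS (subsetUr _ _) iA) /=; apply/subsetP => x xA.
    rewrite !inE negb_or (subsetP uAS) ?andbT; last by rewrite !inE xA orbT.
    rewrite (contraNneq _ uA) => [/=|<- //].
    by move/independentP: iA; apply; rewrite !inE ?eqxx // xA orbT.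
  move=> /andP[/independentP iA /subsetP AS].
  have uA : u \notin A by apply/negP => /AS; rewrite !inE eqxx.
  rewrite setU1K // eqxx andbT; apply/andP; split.
    apply/independentP => x y; rewrite !inE.
    move=> /orP[/eqP ->|xA] /orP[/eqP ->|yA].
    - by rewrite e_irr.
    - by move: (AS y yA); rewrite !inE negb_or => /andP[/andP[]].
    - by rewrite e_sym; move: (AS x xA); rewrite !inE negb_or => /andP[/andP[]].
    - exact: iA.
  apply/subsetP => x; rewrite !inE => /orP[/eqP -> //|/AS].
  by rewrite !inE => /andP[].
rewrite (eq_bigl _ _ E); apply: eq_bigr => A /andP[_ /subsetP AS].
rewrite cardsU1 -exprS; suff -> : u \notin A by [].
by apply/negP => /AS; rewrite !inE eqxx.
Qed.

(** Union bound: a random independent set contains a given vertex with probability at most [lam], so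
    it misses [N u] with probability at least 1 - lam |N u :&: S|. *)
Lemma partition_fun_closed_nbhd (S : {set T}) (u : T) :
  Z S * (1 - lam * #|N u :&: S|%:R) <= Z (S :\: N u).
Proof.
rewrite mulrBr mulr1 lerBlDr.
have H (w : T) : w \in N u :&: S ->
    \sum_(A : {set T} | independent A && (A \subset S)) lam ^+ #|A| * (w \in A)%:R
    <= lam * Z S.
  rewrite inE => /andP[_ wS].
  rewrite (eq_bigr (fun A : {set T} => if w \in A then lam ^+ #|A| else 0)); last first.
    by move=> A _; case: ifP; rewrite ?mulr1 ?mulr0.
  rewrite -big_mkcondr (sum_independent_mem wS) ler_wpM2l // partition_funS //.
  exact: subsetDl.
have {H}: \sum_(w in N u :&: S) \sum_(A : {set T} | independent A && (A \subset S))
   lam ^+ #|A| * (w \in A)%:R <= Z S * (lam * #|N u :&: S|%:R).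
  apply: le_trans (ler_sum _ (fun w Hw => H w Hw)) _.
  by rewrite sumr_const mulrCA mulrA mulr_natr.
move/(lerD (lexx (Z (S :\: N u)))); apply: le_trans.
rewrite exchange_big /= {1}/partition_fun.
rewrite (bigID (fun A : {set T} => A \subset S :\: N u)) /=.
rewrite lerD //.
  rewrite le_eqVlt; apply/orP; left; apply/eqP; apply: eq_bigl => A.
  rewrite -andbA; congr andb; rewrite andb_idl // => AS.
  by apply: (subset_trans AS); exact: subsetDl.
rewrite big_mkcondr /=; apply: ler_sum => A /andP[_ AS].
case: ifPn => [|_]; last first.
  by apply: sumr_ge0 => w _; rewrite mulr_ge0 // exprn_ge0.
case/subsetPn => w wA; rewrite inE (subsetP AS _ wA) andbT negbK => wN.
have wNS : w \in N u :&: S by rewrite inE wN (subsetP AS _ wA).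
rewrite (bigD1 w) //= wA mulr1 lerDl; apply: sumr_ge0 => ? _.
by rewrite mulr_ge0 // exprn_ge0.
Qed.

(** Each new vertex multiplies the partition function by at most 1 + lam <= expR lam. *)
Lemma partition_fun_le_expR (S : {set T}) : Z S <= expR (lam * #|S|%:R).
Proof.
elim: {S}#|S| {1 3}S (erefl #|S|) => [|m IH] S Sm.
  move/eqP: Sm; rewrite cards_eq0 => /eqP ->; rewrite mulr0 expR0 /partition_fun.
  rewrite (bigD1 set0) /=; last first.
    by rewrite sub0set andbT; apply/independentP => x y; rewrite inE.
  rewrite cards0 expr0 big1 ?addr0 // => A /andP[/andP[_]].
  by rewrite subset0 => ->.
have /card_gt0P[u uS] : (0 < #|S|)%N by rewrite Sm.
have SuE : #|S :\ u| = m by move: (cardsD1 u S); rewrite uS Sm => -[].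
have -> : Z S = Z (S :\ u) + lam * Z (S :\: N u).
  rewrite -sum_independent_mem // {1}/partition_fun.
  rewrite (bigID (fun A : {set T} => u \in A)) /= addrC; congr (_ + _).
  apply: eq_bigl => A; rewrite subsetD1 andbA; by [].
apply: (@le_trans _ _ ((1 + lam) * Z (S :\ u))).
  rewrite mulrDl mul1r lerD2l ler_wpM2l // partition_funS //.
  by apply: setDS; apply/subsetP => x; rewrite !inE => /eqP ->; rewrite eqxx.
rewrite -natr1 mulrDr mulr1 [in leRHS]addrC expRD.
apply: ler_pM => //; [exact: addr_ge0|exact: partition_fun_ge0|exact: expR_ge1Dx|].
exact: IH.
Qed.


(** A local count that is large in expectation at every v, while its sum over v is at most 2 D |I|
    once all degrees are at most D. *)
Definition occupied (D : R) (v : T) (I : {set T}) : R :=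
  D * (v \in I)%:R + #|[set u in I | e v u]|%:R.

(** The expected size is the sum over u of the probability of u, that is, of lam Z (S :\: N u) / Z
    S; the union bound controls each term and K their average. *)
Lemma sum_card_independent (S : {set T}) (K : R) :
    \sum_(u in S) #|N u :&: S|%:R <= K * #|S|%:R ->
  Z S * (lam * #|S|%:R * (1 - lam * K)) <=
  \sum_(A : {set T} | independent A && (A \subset S)) lam ^+ #|A| * #|A|%:R.
Proof.
move=> HK.
have -> : \sum_(A : {set T} | independent A && (A \subset S)) lam ^+ #|A| * #|A|%:R =
    \sum_(u in S) lam * Z (S :\: N u).
  rewrite (eq_bigr (fun A : {set T} => \sum_(u in S) (u \in A)%:R * lam ^+ #|A|)).
    rewrite exchange_big /=; apply: eq_bigr => u uS.
    rewrite -sum_independent_mem // [RHS]big_mkcondr /=.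
    by apply: eq_bigr => A _; case: ifP; rewrite ?mul1r ?mul0r.
  move=> A /andP[_ AS]; rewrite -mulr_suml mulrC; congr (_ * _).
  rewrite -natr_sum -sum1_card; congr (_%:R).
  rewrite [LHS]big_mkcond [RHS]big_mkcond /=.
  by apply: eq_bigr => u _; case: ifP => [/(subsetP AS) ->|] //; case: ifP.
apply: (@le_trans _ _ (\sum_(u in S) lam * (Z S * (1 - lam * #|N u :&: S|%:R)))).
  rewrite -mulr_sumr -mulr_sumr -mulrA mulrCA ler_wpM2l //.
  rewrite ler_wpM2l ?partition_fun_ge0 //.
  rewrite sumrB sumr_const -mulr_sumr mulrBr mulr1 lerB //.
  by rewrite mulrCA ler_wpM2l // mulrC.
by apply: ler_sum => u _; rewrite ler_wpM2l // partition_fun_closed_nbhd.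
Qed.

Lemma local_occupied (D K L : R) (v : T) (S : {set T}) :
    0 <= L -> lam <= 1 -> lam * K <= 2^-1 -> expR (6 * L) <= D * lam ->
    S \subset [set u | e v u] ->
    \sum_(u in S) #|N u :&: S|%:R <= K * #|S|%:R ->
  L * (lam + Z S) <= D * lam +
    \sum_(A : {set T} | independent A && (A \subset S)) lam ^+ #|A| * #|A|%:R.
Proof.
move=> L0 lam1 lK HD SN HK.
have HZ1 := partition_fun_ge1 S; have HZe := partition_fun_le_expR S.
have H0 : Z S * (lam * #|S|%:R / 2) <=
   \sum_(A : {set T} | independent A && (A \subset S)) lam ^+ #|A| * #|A|%:R.
  apply: le_trans (sum_card_independent HK).
  rewrite ler_wpM2l ?partition_fun_ge0 // ler_wpM2l ?mulr_ge0 //; lra.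
have LZ : L * (lam + Z S) <= Z S * (2 * L).
  by rewrite -[X in _ <= X]mulrCA mulrA mulrC ler_wpM2r //; lra.
apply: (le_trans LZ).
have tau0 : 0 <= lam * #|S|%:R by rewrite mulr_ge0.
have D0 : 0 <= D * lam by apply: le_trans HD; exact: expR_ge0.
(* If lam |S| >= 4 L, the expected size is at least 2 L. Otherwise Z S <= expR (4 L), and D lam >=
   expR (6 L) dominates 2 L Z S because 2 L <= expR (2 L). *)
have [h|h] := lerP (4 * L) (lam * #|S|%:R).
  apply: (@le_trans _ _ (Z S * (lam * #|S|%:R / 2))); last by lra.
  by rewrite ler_wpM2l ?partition_fun_ge0 //; lra.
rewrite -[leLHS]addr0 lerD //; last first.
  by apply: le_trans H0; rewrite mulr_ge0 ?partition_fun_ge0 // divr_ge0.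
apply: le_trans HD.
rewrite (_ : 6 * L = 4 * L + 2 * L); last by ring.
rewrite expRD ler_pM ?partition_fun_ge0 //; first by lra.
  by apply: (le_trans HZe); rewrite ler_expR; lra.
by apply: le_trans _ (expR_ge1Dx _); lra.
Qed.

Definition free_nbhd (v : T) (J : {set T}) : {set T} :=
  [set u | e v u & [forall w in J, ~~ e u w]].

(** Given its part J outside [N v], an independent set is completed either by v alone or by an
    independent set of neighbours of v not adjacent to J. *)
Lemma independent_fiber (v : T) (J A : {set T}) :
    J :&: N v = set0 -> independent J ->
  [&& independent (J :|: A), (J :|: A) :\: N v == J & (J :|: A) :&: N v == A]
  = (A == [set v]) || (independent A && (A \subset free_nbhd v J)).
Proof.
move=> JN iJ.
have JNP x : x \in J -> x \notin N v.
  by move=> xJ; apply/negP => xN; move/setP/(_ x): JN; rewrite !inE xJ; move: xN; rewrite inE => ->.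
have fibP : A \subset N v -> ((J :|: A) :\: N v == J) && ((J :|: A) :&: N v == A).
  move=> /subsetP AN; apply/andP; split; apply/eqP/setP => x; rewrite ?in_setI ?in_setD in_setU.
    have [xN|xN] := boolP (x \in N v).
      by apply/esym/negP => /JNP; rewrite xN.
    by rewrite orb_idr //= => /AN; rewrite (negbTE xN).
  have [xA|xA] := boolP (x \in A); first by rewrite orbT AN.
  by rewrite orbF; apply/negP => /andP[/JNP/negP].
apply/idP/idP.
  move=> /and3P[iU _ /eqP UA].
  have AN : A \subset N v by rewrite -UA subsetIr.
  have iA : independent A := independentS (subsetUr _ _) iU.
  have [vA|vA] := boolP (v \in A).
    apply/orP; left; rewrite eqEsubset sub1set vA andbT; apply/subsetP => x xA.
    have := subsetP AN x xA; rewrite !inE => /orP[//|vx].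
    by have := independentP _ iA v x vA xA; rewrite vx.
  rewrite iA; apply/orP; right; apply/subsetP => x xA; rewrite inE.
  have := subsetP AN x xA; rewrite !inE => /orP[/eqP xv|->].
    by move: vA; rewrite -xv xA.
  apply/forall_inP => w wJ; apply: (independentP _ iU); by rewrite inE ?xA ?wJ ?orbT.
move=> H.
have AN : A \subset N v.
  case/orP: H => [/eqP ->|/andP[_ /subsetP H]].
    by apply/subsetP => x; rewrite !inE => ->.
  by apply/subsetP => x /H; rewrite !inE => /andP[->]; rewrite orbT.
rewrite fibP // andbT; apply/independentP.
have iA : independent A.
  case/orP: H => [/eqP ->|/andP[//]].
  by apply/independentP => x y; rewrite !inE => /eqP -> /eqP ->; rewrite e_irr.
have cross x y : x \in J -> y \in A -> ~~ e y x.
  move=> xJ yA; case/orP: H => [/eqP Av|/andP[_ /subsetP H]].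
    move: yA; rewrite Av inE => /eqP ->.
    by have := JNP x xJ; rewrite !inE negb_or => /andP[].
  by have := H y yA; rewrite inE => /andP[_ /forall_inP]; apply.
move=> x y; rewrite !inE => /orP[xJ|xA] /orP[yJ|yA].
- exact: (independentP _ iJ).
- by rewrite e_sym; apply: cross.
- exact: cross.
- exact: (independentP _ iA).
Qed.

Lemma occupied_ge (D K L : R) (v : T) :
    0 <= L -> lam <= 1 -> lam * K <= 2^-1 -> expR (6 * L) <= D * lam ->
    (forall S : {set T}, S \subset [set u | e v u] ->
      \sum_(u in S) #|N u :&: S|%:R <= K * #|S|%:R) ->
  L * (\sum_(I : {set T} | independent I) lam ^+ #|I|) <=
  \sum_(I : {set T} | independent I) lam ^+ #|I| * occupied D v I.
Proof.
move=> L0 lam1 lK HD HK; rewrite mulr_sumr.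
pose f (I : {set T}) := I :\: N v.
(* Conditioning on the part outside [N v]: it suffices to compare the two sums fibre by fibre, where
   [local_occupied] applies. *)
rewrite (partition_big f predT) //= [leRHS](partition_big f predT) //=.
apply: ler_sum => J _.
have [iJ|/negP iJ] := boolP (independent J); last first.
  rewrite !big1 // => I /andP[iI /eqP fI]; exfalso; apply: iJ; rewrite -fI.
  1,2: exact: independentS (subsetDl _ _) iI.
have [JN|/eqP JN] := eqVneq (J :&: N v) set0; last first.
  rewrite !big1 // => I /andP[iI /eqP fI]; exfalso; apply: JN; rewrite -fI.
  1,2: by apply/setP => x; rewrite /f !inE; case: (_ || _); rewrite ?andbF.
have re (g : {set T} -> R) : \sum_(I : {set T} | independent I && (f I == J)) g I =
    g (J :|: [set v]) + \sum_(A : {set T} | independent A && (A \subset free_nbhd v J)) g (J :|: A).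
  rewrite (reindex_onto (fun A => J :|: A) (fun I => I :&: N v)) /=; last first.
    by move=> I /andP[_ /eqP <-]; rewrite /f setUC setID.
  rewrite (eq_bigl (fun A : {set T} => (A == [set v]) || (independent A && (A \subset free_nbhd v J)))).
    rewrite (bigD1 [set v]) /= ?eqxx //; congr (_ + _); apply: eq_bigl => A.
    have [->|] := eqVneq A [set v]; rewrite ?andbT ?andbF //=.
    by rewrite sub1set !inE e_irr andbF.
  by move=> A; rewrite -independent_fiber // andbA.
have JA0 (A : {set T}) : A \subset N v -> J :&: A = set0.
  move=> AN; apply/eqP; rewrite -subset0 -JN; exact: setIS.
have FN : free_nbhd v J \subset [set u | e v u].
  by apply/subsetP => x; rewrite !inE => /andP[].
have FN' (A : {set T}) : A \subset free_nbhd v J -> A \subset N v.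
  move=> /subsetP AF; apply/subsetP => x /AF /(subsetP FN); rewrite !inE => ->.
  by rewrite orbT.
have cJ (A : {set T}) : A \subset N v -> #|J :|: A| = (#|J| + #|A|)%N.
  by move=> AN; rewrite cardsU JA0 // cards0 subn0.
have vN : [set v] \subset N v by rewrite sub1set inE eqxx.
rewrite !re !cJ // cards1.
rewrite (eq_bigr (fun A : {set T} => lam ^+ #|J| * (L * lam ^+ #|A|))); last first.
  by move=> A /andP[_ /FN' AN]; rewrite cJ // exprD mulrCA.
rewrite -mulr_sumr -mulr_sumr addn1 exprSr mulrCA -mulrDr.
rewrite -mulrDr -/(Z _).
apply: (@le_trans _ _ (lam ^+ #|J| * (D * lam + \sum_(A : {set T} | independent A && (A \subset free_nbhd v J)) lam ^+ #|A| * #|A|%:R))).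
  by rewrite ler_wpM2l ?exprn_ge0 //; apply: (@local_occupied D K L v) => //; exact: HK.
rewrite mulrDr mulr_sumr lerD //.
  rewrite -mulrA ler_wpM2l ?exprn_ge0 // mulrC ler_wpM2l //.
  by rewrite /occupied !inE eqxx orbT mulr1 lerDl.
apply: ler_sum => A /andP[_ AF].
rewrite cJ ?FN' // exprD -mulrA ler_wpM2l ?exprn_ge0 // ler_wpM2l ?exprn_ge0 //.
rewrite /occupied addrC ler_wpDr //.
  have : 0 < D * lam by apply: lt_le_trans HD; exact: expR_gt0.
  have [->|lam_pos] := eqVneq lam 0; first by rewrite mulr0 ltxx.
  have lp : 0 < lam by rewrite lt_def lam_pos.
  by rewrite pmulr_lgt0 // => D0; rewrite mulr_ge0 // ltW.
rewrite ler_nat subset_leq_card //; apply/subsetP => x xA; rewrite !inE xA orbT.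
by have := subsetP FN _ (subsetP AF x xA); rewrite inE.
Qed.

End HardCore.

(** * From local estimates to one large independent set *)

Section LargeIndependentSet.
Import fintype mathcomp.boot.finset.

(** Of two adjacent vertices at least one has the larger or equal value of f, so every pair is
    counted from that end; doubling covers both orders. *)
Lemma sum_closed_nbhd_le (R : realType) (T : finType) (e : rel T) (f : T -> R)
    (K : R) (S : {set T}) : symmetric e ->
    (forall u, u \in S -> #|[set w in closed_nbhd e u | f w <= f u]|%:R <= K) ->
  \sum_(u in S) #|closed_nbhd e u :&: S|%:R <= 2 * K * #|S|%:R.
Proof.
move=> e_sym HK.
pose g (u w : T) : R := ((w \in closed_nbhd e u) && (f w <= f u))%:R.
have gK u : u \in S -> \sum_(w in S) g u w <= K.
  move=> uS; apply: le_trans (HK u uS).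
  rewrite -natr_sum ler_nat -sum1_card [leqLHS]big_mkcond [leqRHS]big_mkcond /=.
  by apply: leq_sum => w _; rewrite inE; case: (w \in S) => //; case: (_ && _).
apply: (@le_trans _ _ (\sum_(u in S) \sum_(w in S) (g u w + g w u))).
  apply: ler_sum => u uS; rewrite -sum1_card natr_sum big_mkcond [leRHS]big_mkcond /=.
  apply: ler_sum => w _; rewrite inE andbC; case: (w \in S) => //=.
  have Ewu : (u \in closed_nbhd e w) = (w \in closed_nbhd e u).
    by rewrite !inE eq_sym e_sym.
  rewrite /g Ewu; case: (w \in closed_nbhd e u) => /=; last by rewrite addr0.
  by case: (leP (f w) (f u)) => [_|/ltW ->]; rewrite ?add0r // lerDl.
rewrite (eq_bigr (fun u => \sum_(w in S) g u w + \sum_(w in S) g w u)); last first.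
  by move=> u _; rewrite big_split.
rewrite big_split /= [X in _ + X]exchange_big /= -mulr2n -mulrA mulr_natl.
rewrite lerMn2r /= mulrC mulr_natl -sumr_const; exact: ler_sum.
Qed.

Theorem large_independent_set (R : realType) (T : finType) (e : rel T)
    (f : T -> T -> R) (D K L : R) :
    symmetric e -> irreflexive e -> 0 <= L -> 1 <= K ->
    (forall v, #|[set u | e v u]|%:R <= D) ->
    (forall v u, e v u ->
      #|[set w in closed_nbhd e u | f v w <= f v u]|%:R <= K) ->
    expR (6 * L) <= D / (4 * K) ->
  exists2 I : {set T}, independent e I & L * #|T|%:R <= 2 * D * #|I|%:R.
Proof.
move=> e_sym e_irr L0 K1 HD HK HE.
(* The average closed degree is at most 2 K, so this makes the union bound lose at most one half. *)
pose lam := (4 * K)^-1.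
have K4 : 0 < 4 * K by lra.
have lam0 : 0 < lam by rewrite invr_gt0.
have lam1 : lam <= 1 by rewrite invf_le1 //; lra.
have lamK : lam * (2 * K) <= 2^-1.
  have Kn0 : K != 0 by rewrite gt_eqF //; lra.
  by rewrite le_eqVlt; apply/orP; left; apply/eqP; rewrite /lam; field.
have KS (v : T) (S : {set T}) : S \subset [set u | e v u] ->
    \sum_(u in S) #|closed_nbhd e u :&: S|%:R <= 2 * K * #|S|%:R.
  move=> /subsetP SN; apply: (sum_closed_nbhd_le (f := f v)) => // u uS.
  by apply: HK; have := SN u uS; rewrite inE.
have loc v := occupied_ge e_sym e_irr (ltW lam0) L0 lam1 lamK HE (KS v).
pose W := \sum_(I : {set T} | independent e I) lam ^+ #|I|.
have occ (I : {set T}) : \sum_v occupied e D v I <= 2 * D * #|I|%:R.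
  rewrite big_split /= -mulr_sumr -natr_sum -mulrA mulr_natl mulr2n.
  rewrite lerD //.
    rewrite -sum1_card [in leRHS]big_mkcond /= (eq_bigr (fun i => if i \in I then 1%N else 0%N)) //.
  rewrite (eq_bigr (fun v => \sum_(u in I) (e v u)%:R)); last first.
    move=> v _; rewrite -natr_sum -sum1_card big_mkcond [in RHS]big_mkcond /=.
    by congr (_%:R); apply: eq_bigr => u _; rewrite inE; case: (u \in I) => //=; case: (e v u).
  rewrite exchange_big /= mulr_natr -sumr_const.
  apply: ler_sum => u _; apply: le_trans (HD u).
  rewrite -natr_sum -sum1_card big_mkcond [in leRHS]big_mkcond /= ler_nat.
  by apply: leq_sum => w _; rewrite inE e_sym; case: (e u w).
have W0 : 0 < W.
  rewrite /W (bigD1 set0) /=; last first.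
    by apply/independentP => x y; rewrite inE.
  rewrite cards0 expr0 ltr_wpDr //; apply: sumr_ge0 => A _.
  by rewrite exprn_ge0 // ltW.
(* If every independent set were small, so would be the weighted average of its total [occupied]
   count, against the lower bound at each vertex. *)
apply: contrapT => hno.
have lt_all (I : {set T}) : independent e I -> 2 * D * #|I|%:R < L * #|T|%:R.
  by move=> iI; rewrite ltNge; apply/negP => h; apply: hno; exists I.
have : \sum_(v : T) L * W <= \sum_(v : T) \sum_(I : {set T} | independent e I) lam ^+ #|I| * occupied e D v I.
  by apply: ler_sum => v _; exact: loc.
rewrite exchange_big /= sumr_const -mulr_natr => h.
have : W * (L * #|T|%:R) < W * (L * #|T|%:R); last by rewrite ltxx.
apply: (@le_lt_trans _ _ (\sum_(I : {set T} | independent e I) lam ^+ #|I| * (2 * D * #|I|%:R))).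
  rewrite (_ : W * (L * #|T|%:R) = L * W * #|T|%:R); last by ring.
  apply: (le_trans h); apply: ler_sum => I _; rewrite -mulr_sumr ler_wpM2l //.
  by rewrite exprn_ge0 // ltW.
rewrite /W mulr_suml; apply: ltr_sum.
  apply/hasP; exists set0; rewrite ?mem_index_enum //; by apply/independentP => x y; rewrite inE.
by move=> I iI; rewrite ltr_pM2l ?exprn_gt0 // lt_all.
Qed.

End LargeIndependentSet.

(** * Uniform convexity of the superball norm *)

Section PowerConvexity.
Variable R : realType.
Implicit Types (p s t w d : R).

Lemma powR_divr p (a s : R) : 0 <= a -> 0 < s -> (a / s) `^ p = a `^ p / s `^ p.
Proof.
move=> a0 s0; have sp : s `^ p != 0 by rewrite gt_eqF ?powR_gt0.
apply: (canRL (mulfK sp)); rewrite -powRM ?divr_ge0 ?(ltW s0) //.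
by rewrite divfK // gt_eqF.
Qed.

(** With y = expR t, the power factors as expR t times expR ((p - 1) t); both are compared with the
    tangent of the exponential. *)
Lemma powR_gt_tangent p (y : R) : 1 < p -> 0 < y -> y != 1 -> 1 + p * (y - 1) < y `^ p.
Proof.
move=> p1 y0 y1; have [t ty] := expR_total y0; rewrite -ty in y1 *.
have t0 : t != 0 by apply: contraNneq y1 => ->; rewrite expR0.
rewrite -expRM (_ : t * p = t + (p - 1) * t) ?expRD; last by ring.
have e0 := expR_gt0 t.
have pt0 : (p - 1) * t != 0 by rewrite mulf_neq0 // gt_eqF // subr_gt0.
have h1 := expR_gt1Dx pt0.
have h2 := expR_ge1Dx (- t).
apply: (@le_lt_trans _ _ (expR t * (1 + (p - 1) * t))); last by rewrite ltr_pM2l.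
have : expR t * expR (- t) = 1 by rewrite expRN divff ?gt_eqF.
have : expR t * (1 - t) <= expR t * expR (- t) by rewrite ler_pM2l.
move=> h3 h4; rewrite h4 in h3.
rewrite -subr_ge0 (_ : _ - _ = (p - 1) * (1 - expR t * (1 - t))); last by ring.
by rewrite mulr_ge0 // subr_ge0 // ltW.
Qed.

Lemma powR_ge_tangent p (y : R) : 1 < p -> 0 <= y -> 1 + p * (y - 1) <= y `^ p.
Proof.
move=> p1; rewrite le_eqVlt => /orP[/eqP <-|y0].
  by rewrite powR0 ?gt_eqF //; lra.
by have [->|y1] := eqVneq y 1; [rewrite powR1; lra|rewrite ltW // powR_gt_tangent].
Qed.

Lemma powR_convex p (l a b : R) : 1 < p -> 0 <= l <= 1 -> 0 <= a -> 0 <= b ->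
  (l * a + (1 - l) * b) `^ p <= l * a `^ p + (1 - l) * b `^ p.
Proof.
move=> p1 /andP[l0 l1] a0 b0.
set c := l * a + (1 - l) * b.
have c0 : 0 <= c by rewrite addr_ge0 // mulr_ge0 // subr_ge0.
have [cz|cn] := eqVneq c 0.
  rewrite cz powR0; last by lra.
  by rewrite addr_ge0 // mulr_ge0 ?powR_ge0 // subr_ge0.
have cp : 0 < c by rewrite lt_def cn.
have tan (x : R) : 0 <= x -> c `^ p * (1 + p * (x / c - 1)) <= x `^ p.
  move=> x0; have xc : 0 <= x / c by rewrite divr_ge0.
  rewrite -[in leRHS](divfK cn x) [in leRHS]mulrC powRM //.
  by rewrite ler_wpM2l ?powR_ge0 // powR_ge_tangent.
(* Both values are bounded below by the tangent at the mean c, and the linear terms cancel in the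
   average. *)
apply: (@le_trans _ _ (l * (c `^ p * (1 + p * (a / c - 1))) +
                      (1 - l) * (c `^ p * (1 + p * (b / c - 1))))).
  rewrite le_eqVlt; apply/orP; left; apply/eqP.
  have -> : l * (c `^ p * (1 + p * (a / c - 1))) + (1 - l) * (c `^ p * (1 + p * (b / c - 1)))
     = c `^ p * (1 + p * ((l * a + (1 - l) * b) / c - 1)) by ring.
  by rewrite -/c divff // subrr mulr0 addr0 mulr1.
by rewrite lerD // ler_wpM2l ?tan // subr_ge0.
Qed.

Lemma powR_mean p s t : 1 < p -> 0 <= s -> 0 <= t ->
  ((s + t) / 2) `^ p <= (s `^ p + t `^ p) / 2.
Proof.
move=> p1 s0 t0; have := @powR_convex p 2^-1 s t p1 _ s0 t0.
rewrite (_ : 2^-1 * s + (1 - 2^-1) * t = (s + t) / 2); last by field.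
rewrite (_ : 2^-1 * s `^ p + (1 - 2^-1) * t `^ p = (s `^ p + t `^ p) / 2); last by field.
by apply; lra.
Qed.

(** Scaled to mean 1, the pair is 1 + x, 1 - x with x >= e. By convexity the excess of the mean of
    the powers over 1 is at least its value at x = e, which is kappa. *)
Lemma powR_mean_strict p (e : R) : 1 < p -> 0 < e < 1 ->
  exists2 kappa : R, 0 < kappa & forall s t : R, 0 <= t -> t <= s -> e * (s + t) <= s - t ->
    ((s + t) / 2) `^ p * (1 + kappa) <= (s `^ p + t `^ p) / 2.
Proof.
move=> p1 /andP[e0 e1].
exists (((1 + e) `^ p + (1 - e) `^ p) / 2 - 1).
  have h1 := @powR_gt_tangent p (1 + e) p1 ltac:(lra) ltac:(lra).
  have h2 := @powR_gt_tangent p (1 - e) p1 ltac:(lra) ltac:(lra).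
  lra.
move=> s t t0 ts est.
rewrite [1 + _]addrC subrK.
set m := (s + t) / 2.
have [m0|mn] := eqVneq m 0.
  rewrite m0 powR0; last by lra.
  by rewrite mul0r divr_ge0 // addr_ge0 // powR_ge0.
have mp : 0 < m by rewrite lt_def mn /m; lra.
pose x := (s - t) / 2 / m.
have sE : s = m * (1 + x) by rewrite /x /m in mn *; field; lra.
have tE : t = m * (1 - x) by rewrite /x /m in mn *; field; lra.
have x1 : 0 <= 1 - x by move: t0; rewrite tE pmulr_rge0.
have ex : e <= x by rewrite /x ler_pdivlMr // /m; lra.
have x0 : 0 < x by lra.
rewrite sE tE (@powRM _ m (1 + x)) ?(@powRM _ m (1 - x)) ?(ltW mp) //; try by lra.
rewrite -mulrDr -mulrA ler_wpM2l ?powR_ge0 //.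
have lx : 0 <= e / x <= 1 by apply/andP; split; [rewrite divr_ge0 ?ltW|rewrite ler_pdivrMr ?mul1r].
have c1 := @powR_convex p (e / x) (1 + x) 1 p1 lx ltac:(lra) ltac:(lra).
have c2 := @powR_convex p (e / x) (1 - x) 1 p1 lx ltac:(lra) ltac:(lra).
move: c1 c2; rewrite powR1.
have xn : x != 0 by rewrite gt_eqF.
rewrite (_ : e / x * (1 + x) + (1 - e / x) * 1 = 1 + e); last by field.
rewrite (_ : e / x * (1 - x) + (1 - e / x) * 1 = 1 - e); last by field.
have b1 := @powR_ge_tangent p (1 + x) p1 ltac:(lra).
have b2 := @powR_ge_tangent p (1 - x) p1 ltac:(lra).
case/andP: lx => lx0 lx1.
move=> c1 c2.
have : e / x * ((1 + x) `^ p + (1 - x) `^ p - 2) <= 1 * ((1 + x) `^ p + (1 - x) `^ p - 2).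
  by rewrite ler_wpM2r //; lra.
lra.
Qed.

(* [s], [t], [d], [w] are the lengths of vectors [x], [y], [x - y] and
   [(x + y) / 2] of a Euclidean space, linked by the parallelogram identity. *)
Lemma powR_midpoint_gain p (e : R) : 1 < p -> 0 < e < 1 ->
  exists2 delta : R, 0 < delta < 1 & forall s t d w : R,
    0 <= s -> 0 <= t -> 0 <= w -> w <= (s + t) / 2 ->
    w ^+ 2 = (s ^+ 2 + t ^+ 2) / 2 - d ^+ 2 / 4 -> e * (s + t) <= d ->
    w `^ p <= (1 - delta) * ((s `^ p + t `^ p) / 2).
Proof.
move=> p1 /andP[e0 e1].
have [kappa k0 Hk] := @powR_mean_strict p (e / 2) p1 ltac:(lra).
(* For |s - t| <= (e/2)(s + t) and d >= e (s + t), the parallelogram identity gives w^2 <= ((s +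
   t)/2)^2 (1 + e^2/4 - e^2). *)
pose theta := Num.sqrt (1 - 3 / 4 * e ^+ 2).
have ee : 0 < e ^+ 2 < 1 by rewrite exprn_gt0 //= exprn_ilt1 // ltW.
have th0 : 0 < theta by rewrite sqrtr_gt0; lra.
have th2 : theta ^+ 2 = 1 - 3 / 4 * e ^+ 2 by rewrite sqr_sqrtr //; lra.
have th1 : theta < 1.
  by rewrite -(@ltr_pXn2r _ 2) ?nnegrE ?ltW // th2 expr1n; lra.
have kk : 0 < kappa / (1 + kappa) < 1.
  by rewrite divr_gt0 //=; [rewrite ltr_pdivrMr; lra|lra].
pose delta := Num.min (kappa / (1 + kappa)) (1 - theta).
have d1 : delta <= kappa / (1 + kappa) by rewrite /delta ge_min lexx.
have d2 : delta <= 1 - theta by rewrite /delta ge_min lexx orbT.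
exists delta.
  by apply/andP; split; [rewrite /delta lt_min; apply/andP; split; lra|lra].
move=> s t d w.
wlog ts : s t / t <= s.
  move=> H s0 t0; have [st|/ltW st] := leP t s; first exact: H.
  by move=> w0; rewrite addrC [s ^+ 2 + _]addrC [s `^ p + _]addrC; apply: H.
move=> s0 t0 w0 wm wE ed.
have h0 : 0 <= (s `^ p + t `^ p) / 2 by rewrite divr_ge0 // addr_ge0 // powR_ge0.
(* Very different lengths gain from strict convexity of the power, nearly equal ones from the
   Euclidean geometry. *)
have [h|h] := lerP (e / 2 * (s + t)) (s - t).
  have mono : w `^ p <= ((s + t) / 2) `^ p.
    by apply: ge0_ler_powR => //; rewrite ?nnegrE //; lra.
  have := Hk s t t0 ts h.
  have : (1 - kappa / (1 + kappa)) * ((s `^ p + t `^ p) / 2) <= (1 - delta) * ((s `^ p + t `^ p) / 2).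
    by rewrite ler_wpM2r //; lra.
  move=> hh1 hh2; apply: le_trans hh1; apply: (le_trans mono).
  rewrite (_ : 1 - kappa / (1 + kappa) = (1 + kappa)^-1); last by field; lra.
  by rewrite [leRHS]mulrC ler_pdivlMr //; lra.
have mm : ((s + t) / 2) `^ p <= (s `^ p + t `^ p) / 2 by apply: powR_mean.
have wth : w <= theta * ((s + t) / 2).
  have tm0 : 0 <= theta * ((s + t) / 2) by rewrite mulr_ge0 ?(ltW th0) //; lra.
  rewrite -(@ler_pXn2r _ 2) ?nnegrE //.
  rewrite wE exprMn th2.
  have : (e * (s + t)) ^+ 2 <= d ^+ 2.
    by rewrite ler_pXn2r // nnegrE; [rewrite mulr_ge0|apply: le_trans ed; rewrite mulr_ge0]; lra.
  have : (s - t) ^+ 2 <= (e / 2 * (s + t)) ^+ 2.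
    have es0 : 0 <= e * (s + t) by rewrite mulr_ge0 ?(ltW e0) ?addr_ge0.
    by rewrite ler_pXn2r ?nnegrE //; lra.
  by move=> *; lra.
apply: (@le_trans _ _ (theta `^ p * ((s + t) / 2) `^ p)).
  rewrite -powRM ?(ltW th0) //; last by lra.
  by apply: ge0_ler_powR => //; rewrite ?nnegrE //; lra.
have thp : theta `^ p <= theta by apply: ge1r_powR; lra.
apply: ler_pM; rewrite ?powR_ge0 //; lra.
Qed.

End PowerConvexity.

Section EuclideanBlock.
Variables (R : realType) (I : finType) (P : pred I).
Implicit Types x y : I -> R.

Definition enorm x : R := Num.sqrt (\sum_(i | P i) x i ^+ 2).

Lemma enorm_ge0 x : 0 <= enorm x.
Proof. exact: sqrtr_ge0. Qed.

Lemma sqr_enorm x : enorm x ^+ 2 = \sum_(i | P i) x i ^+ 2.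
Proof. by rewrite sqr_sqrtr // sumr_ge0 // => i _; exact: sqr_ge0. Qed.

Lemma enormZ (a : R) x : enorm (fun i => a * x i) = `|a| * enorm x.
Proof.
rewrite /enorm (eq_bigr (fun i => a ^+ 2 * x i ^+ 2)); last by move=> i _; rewrite exprMn.
by rewrite -mulr_sumr sqrtrM ?sqr_ge0 // sqrtr_sqr.
Qed.

Lemma ler_enorm x i : P i -> `|x i| <= enorm x.
Proof.
move=> Pi; rewrite -sqrtr_sqr ler_wsqrtr // (bigD1 i) //= lerDl.
by apply: sumr_ge0 => j _; exact: sqr_ge0.
Qed.

Lemma enorm_mono x y : (forall i, `|x i| <= `|y i|) -> enorm x <= enorm y.
Proof.
move=> xy; rewrite ler_wsqrtr //; apply: ler_sum => i _.
by rewrite -(real_normK (num_real (x i))) -(real_normK (num_real (y i))) ler_pXn2r ?nnegrE.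
Qed.

Lemma enorm_dot x y : \sum_(i | P i) x i * y i <= enorm x * enorm y.
Proof.
have dot0 (z : I -> R) (z' : I -> R) : enorm z = 0 -> \sum_(i | P i) z i * z' i = 0.
  move=> z0; apply: big1 => i Pi.
  by have := ler_enorm z Pi; rewrite z0 normr_le0 => /eqP ->; rewrite mul0r.
have [x0|xn] := eqVneq (enorm x) 0; first by rewrite dot0 // x0 mul0r.
have [y0|yn] := eqVneq (enorm y) 0.
  rewrite (eq_bigr (fun i => y i * x i)) ?dot0 ?y0 ?mulr0 // => i _; exact: mulrC.
have xp : 0 < enorm x by rewrite lt_def xn enorm_ge0.
have yp : 0 < enorm y by rewrite lt_def yn enorm_ge0.
(* Expanding this sum of squares gives the Cauchy-Schwarz inequality. *)
have : 0 <= \sum_(i | P i) (x i * enorm y - y i * enorm x) ^+ 2.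
  by apply: sumr_ge0 => i _; exact: sqr_ge0.
rewrite (eq_bigr (fun i => enorm y ^+ 2 * x i ^+ 2 + enorm x ^+ 2 * y i ^+ 2
   - 2 * enorm x * enorm y * (x i * y i))); last by move=> i _; ring.
rewrite sumrB big_split /= -!mulr_sumr -!sqr_enorm.
rewrite (_ : _ - _ = 2 * (enorm x * enorm y) *
  (enorm x * enorm y - \sum_(i | P i) x i * y i)); last by ring.
by rewrite pmulr_rge0 ?subr_ge0 // mulr_gt0 // mulr_gt0.
Qed.

Lemma ler_enormD x y : enorm (fun i => x i + y i) <= enorm x + enorm y.
Proof.
rewrite -(@ler_pXn2r _ 2) ?nnegrE ?addr_ge0 ?enorm_ge0 //.
rewrite sqr_enorm (eq_bigr (fun i => x i ^+ 2 + y i ^+ 2 + 2 * (x i * y i))); last first.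
  by move=> i _; ring.
rewrite !big_split /= -mulr_sumr -!sqr_enorm.
by have := enorm_dot x y; lra.
Qed.

Lemma enorm_midpoint x y : enorm (fun i => (x i + y i) / 2) ^+ 2 =
  (enorm x ^+ 2 + enorm y ^+ 2) / 2 - enorm (fun i => x i - y i) ^+ 2 / 4.
Proof.
rewrite !sqr_enorm -big_split /= !mulr_suml -sumrB; apply: eq_bigr => i _; by field.
Qed.

End EuclideanBlock.

(** * Norm properties of the superball norm *)

Section Supnorm.
Variables (R : realType) (p : R) (n m : nat) (k : nat -> nat).
Hypothesis p_gt1 : 1 < p.
Implicit Types x y : 'I_n -> R.

Local Notation N := (@supnorm R p n m k).
Local Notation bn := (fun j => @enorm R 'I_n (fun i : 'I_n => (k j <= i < k j.+1)%N)).

Let p_gt0 : 0 < p. Proof. exact: lt_trans p_gt1. Qed.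
Let p_neq0 : p != 0. Proof. by rewrite gt_eqF. Qed.

Lemma supnormE x : N x = (\sum_(j < m) bn j x `^ p) `^ p^-1.
Proof. by []. Qed.

Lemma supnorm_ge0 x : 0 <= N x.
Proof. exact: powR_ge0. Qed.

(* Unification otherwise unfolds [powR] when comparing two norms. *)
Opaque supnorm.

Lemma supnorm_pow x : N x `^ p = \sum_(j < m) bn j x `^ p.
Proof.
by rewrite supnormE -powRrM mulVf // powRr1 // sumr_ge0 // => j _; exact: powR_ge0.
Qed.

Lemma supnorm_leP x (c : R) : 0 <= c ->
  N x <= c <-> \sum_(j < m) bn j x `^ p <= c `^ p.
Proof.
move=> c0; rewrite -supnorm_pow; split => h.
  by apply: ge0_ler_powR; rewrite ?nnegrE ?supnorm_ge0 // ltW.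
apply: contraTT h; rewrite -!ltNge => h.
by apply: gt0_ltr_powR; rewrite ?nnegrE ?supnorm_ge0.
Qed.

Lemma supnormZ (a : R) x : N (fun i => a * x i) = `|a| * N x.
Proof.
rewrite !supnormE (eq_bigr (fun j : 'I_m => `|a| `^ p * bn j x `^ p)); last first.
  by move=> j _; rewrite enormZ powRM ?enorm_ge0.
rewrite -mulr_sumr powRM ?powR_ge0 //; last by apply: sumr_ge0 => j _; exact: powR_ge0.
by rewrite -powRrM mulfV // powRr1.
Qed.

Lemma eq_supnorm x y : x =1 y -> N x = N y.
Proof. by move=> xy; congr supnorm; apply/funext. Qed.

Lemma supnormN x : N (fun i => - x i) = N x.
Proof.
rewrite (@eq_supnorm _ (fun i => -1 * x i)) ?supnormZ ?normrN1 ?mul1r // => i.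
by rewrite mulN1r.
Qed.

Lemma supnormBC x y : N (fun i => x i - y i) = N (fun i => y i - x i).
Proof. by rewrite -supnormN; apply: eq_supnorm => i; rewrite opprB. Qed.

Lemma supnorm0 : N (fun=> 0) = 0.
Proof.
rewrite (@eq_supnorm _ (fun i => 0 * 0)) ?supnormZ ?normr0 ?mul0r //.
Qed.

(** In each block, (x + y)/(s + t) is a convex combination of x/s and y/t, so convexity of the power
    suffices after summation. *)
Lemma supnormD_le x y (s t : R) : 0 < s -> 0 < t -> N x <= s -> N y <= t ->
  N (fun i => x i + y i) <= s + t.
Proof.
move=> s0 t0 /(supnorm_leP x (ltW s0)) xs /(supnorm_leP y (ltW t0)) yt.
apply/(supnorm_leP _ (addr_ge0 (ltW s0) (ltW t0))).
pose l := s / (s + t).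
have st : 0 < s + t by rewrite addr_gt0.
have l01 : 0 <= l <= 1.
  by apply/andP; split; [rewrite divr_ge0 // ltW|rewrite ler_pdivrMr // mul1r lerDl ltW].
have l' : 1 - l = t / (s + t) by rewrite /l; field; rewrite gt_eqF.
have ps : 0 <= s^-1 by rewrite invr_ge0 ltW.
have pt : 0 <= t^-1 by rewrite invr_ge0 ltW.
have l0 : 0 <= l by case/andP: l01.
have l1 : 0 <= 1 - l by rewrite l' divr_ge0 // ltW.
have step (j : 'I_m) : bn j (fun i => x i + y i) `^ p <=
    (s + t) `^ p * (l * (bn j x `^ p / s `^ p) + (1 - l) * (bn j y `^ p / t `^ p)).
  have xs0 : 0 <= bn j x / s by rewrite mulr_ge0 ?enorm_ge0.
  have yt0 : 0 <= bn j y / t by rewrite mulr_ge0 ?enorm_ge0.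
  have c0 : 0 <= l * (bn j x / s) + (1 - l) * (bn j y / t).
    by rewrite addr_ge0 // mulr_ge0.
  apply: (@le_trans _ _ (((s + t) * (l * (bn j x / s) + (1 - l) * (bn j y / t))) `^ p)).
    apply: ge0_ler_powR; first exact: ltW.
    - by rewrite nnegrE enorm_ge0.
    - by rewrite nnegrE mulr_ge0 // ltW.
    apply: le_trans (ler_enormD _ _ _) _; rewrite l' /l le_eqVlt; apply/orP; left; apply/eqP.
    by field; rewrite !gt_eqF.
  rewrite powRM ?(ltW st) // ler_wpM2l ?powR_ge0 //.
  apply: le_trans (powR_convex p_gt1 l01 xs0 yt0) _.
  by rewrite (powR_divr _ (enorm_ge0 _ x) s0) (powR_divr _ (enorm_ge0 _ y) t0).
apply: (le_trans (ler_sum _ (fun j _ => step j))).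
rewrite -mulr_sumr -[leRHS]mulr1 ler_wpM2l ?powR_ge0 //.
rewrite big_split /= -!mulr_sumr -!mulr_suml.
have sp : 0 < s `^ p by rewrite powR_gt0.
have tp : 0 < t `^ p by rewrite powR_gt0.
rewrite [leRHS](_ : _ = l * 1 + (1 - l) * 1); last by ring.
by rewrite lerD // ler_wpM2l // ler_pdivrMr ?mul1r.
Qed.

Lemma ler_supnormD x y : N (fun i => x i + y i) <= N x + N y.
Proof.
(* A margin e/2 on each side makes both bounds positive even when a norm vanishes. *)
apply/ler_addgt0Pr => e e0.
have gtD (a : R) : 0 <= a -> 0 < a + e / 2 /\ a <= a + e / 2 by move=> a0; split; lra.
have sumE (a b : R) : a + e / 2 + (b + e / 2) <= a + b + e by lra.
have [x1 x2] := gtD _ (supnorm_ge0 x); have [y1 y2] := gtD _ (supnorm_ge0 y).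
exact: le_trans (supnormD_le x1 y1 x2 y2) (sumE _ _).
Qed.

Lemma ler_dist_supnormD x y (z : 'I_n -> R) :
  N (fun i => x i - z i) <= N (fun i => x i - y i) + N (fun i => y i - z i).
Proof.
apply: le_trans (ler_supnormD _ _); rewrite le_eqVlt; apply/orP; left; apply/eqP.
by apply: eq_supnorm => i; rewrite addrA subrK.
Qed.

Lemma supnorm_mono x y : (forall i, `|x i| <= `|y i|) -> N x <= N y.
Proof.
move=> xy; apply/(supnorm_leP _ (supnorm_ge0 _)); rewrite supnorm_pow.
apply: ler_sum => j _.
apply: ge0_ler_powR; rewrite ?nnegrE ?enorm_ge0 //; first exact: ltW.
exact: enorm_mono.
Qed.

(** Admissibility makes the blocks exhaust all indices, so i lies in some block, whose Euclidean
    norm is at most [N x]. *)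
Lemma ler_coord_supnorm x i : admissible n m k -> `|x i| <= N x.
Proof.
move=> [k0 [km kS]].
have [j jm /andP[ji ij]] : exists2 j, (j < m)%N & (k j <= i < k j.+1)%N.
  have : (i < k m)%N by rewrite km.
  elim: (m) => [|j IH]; first by rewrite k0.
  have [/IH[l lj il] _|kji] := ltnP i (k j); first by exists l => //; exact: ltnW.
  by move=> ijS; exists j => //; rewrite kji.
have h : bn j x <= N x.
  suff : bn j x `^ p <= N x `^ p.
    apply: contraTT; rewrite -!ltNge => h.
    by apply: gt0_ltr_powR; rewrite ?nnegrE ?supnorm_ge0 ?enorm_ge0.
  rewrite supnorm_pow (bigD1 (Ordinal jm)) //= lerDl.
  by apply: sumr_ge0 => l _; exact: powR_ge0.
by apply: le_trans h; apply: ler_enorm; rewrite ji.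
Qed.

End Supnorm.

(** * Uniform convexity with a constant independent of n and k *)

Section UniformConvexity.
Variables (R : realType) (p : R).
Hypothesis p12 : 1 < p <= 2.

Let p_gt1 : 1 < p. Proof. by case/andP: p12. Qed.

Lemma supnorm_uniform_convexity : exists2 eta : R, 0 < eta <= 2^-1 &
  forall n m k (x y : 'I_n -> R), supnorm p m k x <= 1 -> supnorm p m k y <= 1 ->
    2^-1 <= supnorm p m k (fun i => x i - y i) ->
    supnorm p m k (fun i => (x i + y i) / 2) <= 1 - eta.
Proof.
have p2 : p <= 2 by case/andP: p12.
have p1 := p_gt1; have p0 : 0 <= p by exact: ltW (lt_trans ltr01 p1).
have [delta /andP[delta0 delta1] Hd] := @powR_midpoint_gain R p (32^-1) p_gt1 ltac:(lra).
pose F n m (k : nat -> nat) (x : 'I_n -> R) (j : 'I_m) : R :=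
  @enorm R 'I_n (fun i : 'I_n => (k j <= i < k j.+1)%N) x.
have four : 2 `^ p <= 4 :> R.
  rewrite (_ : 4 = 2 ^+ 2); last by ring.
  by rewrite -powR_mulrn //; apply: ler_powR => //; lra.
have powd (e a b d : R) : 0 <= a -> 0 <= b -> 0 <= d -> 0 <= e <= 1 ->
    d <= e * (a + b) -> d `^ p <= e * (4 * ((a `^ p + b `^ p) / 2)).
  move=> a0 b0 d0 /andP[e0 e1] dj.
  have ab0 : 0 <= (a + b) / 2 by lra.
  apply: (@le_trans _ _ ((e * (2 * ((a + b) / 2))) `^ p)).
    apply: ge0_ler_powR; rewrite ?nnegrE //.
      by rewrite mulr_ge0 // mulr_ge0.
    by lra.
  have m0 : 0 <= 2 * ((a + b) / 2) by lra.
  rewrite (@powRM _ e) // (@powRM _ 2 ((a + b) / 2)) //.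
  rewrite ler_pM ?mulr_ge0 ?powR_ge0 //.
    have [->|en] := eqVneq e 0; first by rewrite powR0 // gt_eqF //; lra.
    by apply: ge1r_powR; rewrite ?lt_def ?en ?e0 // ltW.
  by rewrite ler_pM ?powR_ge0 // powR_mean.
(* An inequality that can be summed over blocks. If d >= (a + b)/32, the gain delta pays for the
   d-term, as d^p <= 4 (a^p + b^p)/2. Otherwise d^p is at most an eighth of the mean and the slack
   delta/32 absorbs it. *)
have block (a b d w : R) : 0 <= a -> 0 <= b -> 0 <= d -> 0 <= w -> d <= a + b ->
    w <= (a + b) / 2 -> w ^+ 2 = (a ^+ 2 + b ^+ 2) / 2 - d ^+ 2 / 4 ->
    w `^ p <= (1 + delta / 32) * ((a `^ p + b `^ p) / 2) - delta / 4 * d `^ p.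
  move=> a0 b0 d0 w0 dab wab wE.
  have h0 : 0 <= (a `^ p + b `^ p) / 2 by rewrite divr_ge0 // addr_ge0 // powR_ge0.
  have [g|bad] := leP (32^-1 * (a + b)) d.
    have := Hd _ _ _ _ a0 b0 w0 wab wE g.
    have := powd 1 a b d a0 b0 d0; rewrite !mul1r lexx ler01 => /(_ isT dab) dj.
    have : delta / 4 * d `^ p <= delta / 4 * (4 * ((a `^ p + b `^ p) / 2)).
      by rewrite ler_wpM2l //; lra.
    have : 0 <= delta / 32 * ((a `^ p + b `^ p) / 2) by rewrite mulr_ge0 //; lra.
    move: ((a `^ p + b `^ p) / 2) (d `^ p) (w `^ p) => h dp wp; lra.
  have wh : w `^ p <= (a `^ p + b `^ p) / 2.
    apply: le_trans (powR_mean p_gt1 a0 b0).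
    by apply: ge0_ler_powR; rewrite ?nnegrE //; lra.
  have dj := powd 32^-1 a b d a0 b0 d0 ltac:(lra) (ltW bad).
  have : delta / 4 * d `^ p <= delta / 4 * (32^-1 * (4 * ((a `^ p + b `^ p) / 2))).
    by rewrite ler_wpM2l //; lra.
  move: wh; move: ((a `^ p + b `^ p) / 2) (d `^ p) (w `^ p) => h dp wp; lra.
(* After summation the loss delta/32 is beaten by delta/16, leaving 1 - delta/32 <= 1 - p delta/64,
   a tangent lower bound for the p-th power. *)
have final (H D W : R) : H <= 1 -> 4^-1 <= D ->
    W <= (1 + delta / 32) * H - delta / 4 * D -> W <= (1 - delta / 64) `^ p.
  move=> H1 D1 WH.
  have tan := @powR_ge_tangent R p (1 - delta / 64) p_gt1 ltac:(lra).
  have : delta / 4 * 4^-1 <= delta / 4 * D by rewrite ler_wpM2l //; lra.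
  have : (1 + delta / 32) * H <= (1 + delta / 32) * 1 by rewrite ler_wpM2l //; lra.
  have : p * delta <= 2 * delta by rewrite ler_wpM2r // ltW.
  move: tan; move: (_ `^ p) => q; lra.
have quarter : 4^-1 <= (2^-1) `^ p :> R.
  have two0 : 0 < 2 `^ p :> R by rewrite powR_gt0.
  have : 2^-1 `^ p * 2 `^ p = 1 :> R by rewrite -powRM ?invr_ge0 // mulVf // powR1.
  move=> /(canRL (mulfK (lt0r_neq0 two0))) ->.
  by rewrite mul1r lef_pV2 ?posrE.
have half (a b : R) : a <= 1 -> b <= 1 -> (a + b) / 2 <= 1 by lra.
have one0 : 0 <= 1 - delta / 64 by lra.
exists (delta / 64); first by lra.
move=> n m k x y x1 y1 xy.
apply/supnorm_leP => //.
have mid0 (j : 'I_m) : F n m k (fun i => (x i + y i) / 2) j <= (F n m k x j + F n m k y j) / 2.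
  rewrite (_ : F _ _ _ _ _ = 2^-1 * F n m k (fun i => x i + y i) j).
    by rewrite mulrC ler_wpM2r ?invr_ge0 // ler_enormD.
  rewrite /F -[X in _ = X * _](@ger0_norm _ 2^-1) ?invr_ge0 // -enormZ.
  by congr enorm; apply/funext => i; rewrite mulrC.
have dist0 (j : 'I_m) : F n m k (fun i => x i - y i) j <= F n m k x j + F n m k y j.
  apply: le_trans (ler_enormD _ _ _) _; rewrite lerD //.
  by apply: enorm_mono => i; rewrite normrN.
apply: (final (\sum_(j < m) (F n m k x j `^ p + F n m k y j `^ p) / 2)
             (\sum_(j < m) F n m k (fun i => x i - y i) j `^ p)).
- rewrite -mulr_suml big_split /=.
  have le1 (z : 'I_n -> R) : supnorm p m k z <= 1 -> \sum_(j < m) F n m k z j `^ p <= 1.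
    by move=> /(supnorm_leP _ _ p_gt1 _ ler01); rewrite powR1.
  by apply: half; exact: le1.
- rewrite -(supnorm_pow m k p_gt1 (fun i => x i - y i)); apply: (le_trans quarter).
  by apply: ge0_ler_powR; rewrite ?nnegrE ?supnorm_ge0 ?invr_ge0 // ltW // (lt_trans _ p_gt1).
rewrite !mulr_sumr -sumrB; apply: ler_sum => j _.
by apply: block; [..|exact: dist0|exact: mid0|exact: enorm_midpoint]; exact: enorm_ge0.
Qed.

(** If |u| <= r/2, the origin is a good centre. Otherwise w and w - u are at distance |u| > r/2 or
    so, and uniform convexity bounds their midpoint w - u/2, so u/2 is a good centre. *)
Lemma lens_in_smaller_ball : exists2 eta : R, 0 < eta <= 2^-1 &
  forall n m k (r : R) (u : 'I_n -> R), 0 < r -> supnorm p m k u <= r ->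
  exists c : 'I_n -> R, forall w : 'I_n -> R,
    supnorm p m k w <= supnorm p m k u ->
    supnorm p m k (fun i => w i - u i) <= r ->
    supnorm p m k (fun i => w i - c i) <= (1 - eta) * r.
Proof.
have [eta e01 He] := supnorm_uniform_convexity.
exists eta; first exact: e01.
move=> n m k r u r0 ur.
have sc (x : 'I_n -> R) : supnorm p m k (fun i => r^-1 * x i) = supnorm p m k x / r.
  by rewrite supnormZ // gtr0_norm ?invr_gt0 // mulrC.
have half_eta : r / 2 <= (1 - eta) * r.
  by clear He ur; rewrite mulrC ler_wpM2r ?(ltW r0) //; lra.
have /orP[ur2|ur2] := le_total (supnorm p m k u) (r / 2).
  exists (fun=> 0) => w wu _.
  have -> : (fun i => w i - 0) = w by apply/funext => i; rewrite subr0.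
  exact: le_trans wu (le_trans ur2 half_eta).
exists (fun i => u i / 2) => w wu wur.
have rn : r != 0 by exact: lt0r_neq0.
have le1 (x : R) : x <= r -> x / r <= 1 by rewrite ler_pdivrMr // mul1r.
have h1 : supnorm p m k (fun i => r^-1 * w i) <= 1.
  by rewrite sc; exact: le1 (le_trans wu ur).
have h2 : supnorm p m k (fun i => r^-1 * (w i - u i)) <= 1.
  by rewrite (sc (fun i => w i - u i)); exact: le1.
have h3 : 2^-1 <= supnorm p m k (fun i => r^-1 * w i - r^-1 * (w i - u i)).
  have -> : (fun i => r^-1 * w i - r^-1 * (w i - u i)) = (fun i => r^-1 * u i).
    by apply/funext => i; rewrite -mulrBr opprB addrC subrK.
  by rewrite sc ler_pdivlMr // mulrC.
have := He n m k _ _ h1 h2 h3.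
have -> : (fun i => (r^-1 * w i + r^-1 * (w i - u i)) / 2) = (fun i => r^-1 * (w i - u i / 2)).
  by apply/funext => i; rewrite -mulrDr -mulrA; congr (_ * _); clear; field.
by rewrite (sc (fun i => w i - u i / 2)) ler_pdivrMr.
Qed.

End UniformConvexity.

(** * Volume and grid points *)

Section Volume.
Variables (R : realType) (n : nat).
Implicit Types (A B : set ('I_n -> R)) (x y : 'I_n -> R).

Lemma le_vol A B : A `<=` B -> (vol A <= vol B)%E.
Proof.
move=> AB; apply: ereal_inf_le_tmp => s [a [b [ab [Bab sE]]]].
by exists a, b; split => //; split => //; exact: subset_trans Bab.
Qed.

Lemma vol_ge0 A : (0 <= vol A)%E.
Proof.
apply: le_ereal_inf_tmp => s [a [b [ab [_ ->]]]].
by apply: nneseries_ge0 => j _ _; rewrite lee_fin prodr_ge0 // => i _; rewrite subr_ge0.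
Qed.

Lemma vol_similarity_le A (s : R) (c : 'I_n -> R) : 0 < s ->
  (vol [set y | A (fun i => (y i - c i) / s)%R] <= (s ^+ n)%:E * vol A)%E.
Proof.
move=> s0; have sn0 : 0 < s ^+ n by rewrite exprn_gt0.
rewrite -lee_pdivrMl //; apply: le_ereal_inf_tmp => v [a [b [ab [Aab ->]]]].
rewrite lee_pdivrMl //; apply: ereal_inf_lbound.
exists (fun j i => s * a j i + c i), (fun j i => s * b j i + c i); split.
  by move=> j i; rewrite lerD2r ler_pM2l.
split=> [y /= /Aab [j _ yab]|].
  exists j => // i; have := yab i.
  by rewrite ler_pdivlMr // ler_pdivrMr // lerBrDr lerBlDr ![_ * s]mulrC.
rewrite -nneseriesZl => [|j _]; last first.
  by rewrite lee_fin prodr_ge0 // => i _; rewrite subr_ge0.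
apply: eq_eseriesr => j _; rewrite -EFinM; congr (_%:E).
have -> : s ^+ n = \prod_(i < n) s by rewrite prodr_const card_ord.
rewrite -big_split /=; apply: eq_bigr => i _.
by ring.
Qed.

Lemma vol_similarity A (s : R) (c : 'I_n -> R) : 0 < s ->
  vol [set y | A (fun i => (y i - c i) / s)] = ((s ^+ n)%:E * vol A)%E.
Proof.
move=> s0; apply/eqP; rewrite eq_le vol_similarity_le //=.
have sn0 : 0 < s ^+ n by rewrite exprn_gt0.
have si0 : 0 < s^-1 by rewrite invr_gt0.
have sn : s != 0 by rewrite gt_eqF.
(* The converse inequality is [vol_similarity_le] for the inverse similarity, which maps B back to
   A. *)
pose B := [set y | A (fun i => (y i - c i) / s)].
have := vol_similarity_le B (fun i => - c i / s) si0.
rewrite (_ : [set y | B _] = A); last first.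
  apply/seteqP; split => y; rewrite /B /=;
    (rewrite (_ : (fun i => _) = y) //; apply/funext => i; field; exact: sn).
move=> h; rewrite muleC -lee_pdivlMr // muleC -exprVn; exact: h.
Qed.

(** Grid points are indexed by a finite type so that they can be counted and serve as graph
    vertices. *)
Definition gridpt (Q : nat) (z : {ffun 'I_n -> 'I_Q}) : 'I_n -> R :=
  fun i => (z i)%:R.

Definition unit_cube (z : 'I_n -> R) : set ('I_n -> R) :=
  [set y | forall i, z i <= y i <= z i + 1].

Lemma vol_le_card (Q : nat) (S : {set {ffun 'I_n -> 'I_Q}}) A : (0 < n)%N ->
  (forall y, A y -> exists2 z, z \in S & unit_cube (gridpt z) y) ->
  (vol A <= #|S|%:R%:E)%E.
Proof.
move=> n0 AS.
(* The finite cover by cubes is padded to a sequence with degenerate boxes, of volume 0 since n >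
   0. *)
pose a j (i : 'I_n) : R := if onth (enum S) j is Some z then gridpt z i else 0.
pose b j (i : 'I_n) : R := if onth (enum S) j is Some z then gridpt z i + 1 else 0.
have onS j : (j < #|S|)%N = onth (enum S) j by rewrite onthTE -cardE.
apply: ereal_inf_lbound; exists a, b; split.
  by move=> j i; rewrite /a /b; case: onth => [z|] //; rewrite lerDl.
split=> [y /AS [z zS yz]|].
  have /onthP[j jz] : z \in enum S by rewrite mem_enum.
  by exists j => // i; rewrite /a /b jz; exact: yz.
rewrite (@nneseries_split _ _ 0 #|S|); last first.
  move=> j _; rewrite lee_fin prodr_ge0 // => i _; rewrite /a /b.
  by case: onth => [z|]; rewrite ?subrr // addrC addKr.
rewrite add0n [X in (_ + X)%E]eseries0 => [|j jS _].
  rewrite adde0 (eq_big_nat _ _ (F2 := fun=> 1%E)).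
    by rewrite big_mkord sumEFin sumr_const card_ord.
  move=> j /andP[_]; rewrite onS /a /b; case: onth => [z _|//].
  by rewrite big1 // => i _; rewrite addrC addKr.
have : ~~ onth (enum S) j by rewrite -onS -leqNgt.
rewrite /a /b; case: onth => // _; congr (_%:E).
by rewrite (bigD1 (Ordinal n0)) //= subrr mul0r.
Qed.

End Volume.

(** * Bounding volumes from below by counting fine grid points *)

Section VolumeLowerBound.
Variable R : realType.

(** Allowing y down to x - 1 lets the induction replace y by Q - 1 when Q itself is counted. *)
Lemma card_interval_le (x : R) (Q : nat) (y : R) : x - 1 <= y ->
  #|[set t : 'I_Q | x <= t%:R <= y]%SET|%:R <= y - x + 1.
Proof.
have E (N : nat) (z : R) : #|[set t : 'I_N | x <= t%:R <= z]%SET| =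
    (\sum_(t < N) (x <= t%:R <= z)%R)%N.
  rewrite -sum1_card big_mkcond /=; apply: eq_bigr => t _.
  by rewrite inE; case: (_ && _).
elim: Q y => [|Q IH] y xy.
  by rewrite E big_ord0; lra.
rewrite E big_ord_recr /= -E.
have [/andP[xQ Qy]|_] := boolP (x <= Q%:R <= y); last by rewrite addn0 IH.
have sub : (#|[set t : 'I_Q | (x <= t%:R <= y)%R]%SET| <=
            #|[set t : 'I_Q | (x <= t%:R <= (Q%:R - 1 : R))%R]%SET|)%N.
  apply: subset_leq_card; apply/fintype.subsetP => t; rewrite !inE => /andP[-> _] /=.
  by rewrite lerBrDr natr1 ler_nat ltn_ord.
rewrite addn1 -natr1; have := IH (Q%:R - 1) ltac:(lra).
have : #|[set t : 'I_Q | (x <= t%:R <= y)%R]%SET|%:R <=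
            #|[set t : 'I_Q | (x <= t%:R <= (Q%:R - 1 : R))%R]%SET|%:R :> R by rewrite ler_nat.
by lra.
Qed.

Lemma prod_addr_le (I : Type) (r : seq I) (l : I -> R) (eta : R) :
    (forall i, 0 <= l i) -> 0 < eta ->
  exists2 e0 : R, 0 < e0 & forall e, 0 <= e <= e0 ->
    \prod_(i <- r) (l i + e) <= \prod_(i <- r) l i + eta.
Proof.
move=> l0; elim: r eta => [|i r IH] eta eta0.
  by exists 1 => // e _; rewrite !big_nil lerDl ltW.
pose P := \prod_(j <- r) l j.
have P0 : 0 <= P by rewrite prodr_ge0.
have l1 : 0 < l i + 1 by rewrite ltr_wpDl.
have [e1 e10 He1] := IH (eta / 2 / (l i + 1)) ltac:(by rewrite !divr_gt0).
have P1 : 0 < P + eta / 2 / (l i + 1) by rewrite ltr_wpDl // !divr_gt0.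
exists (Num.min (Num.min e1 1) (eta / 2 / (P + eta / 2 / (l i + 1)))).
  by rewrite !lt_min e10 ltr01 /= !divr_gt0.
move=> e /andP[e0]; rewrite !le_min => /andP[/andP[ee1 e_1] e2].
rewrite !big_cons -/P.
have := He1 e ltac:(by rewrite e0 ee1); rewrite -/P => HP.
have : (l i + e) * \prod_(j <- r) (l j + e) <= (l i + e) * (P + eta / 2 / (l i + 1)).
  by rewrite ler_wpM2l // addr_ge0.
move/le_trans; apply.
have h1 : e * (P + eta / 2 / (l i + 1)) <= eta / 2 by rewrite -ler_pdivlMr.
have h2 : l i * (eta / 2 / (l i + 1)) <= eta / 2.
  rewrite mulrA ler_pdivrMr // [leLHS]mulrC ler_wpM2l ?lerDl //; lra.
by rewrite mulrDl mulrDr; lra.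
Qed.

Variable n : nat.

Lemma card_gridpt_box (Q M : nat) (a b : 'I_n -> R) : (0 < M)%N ->
    (forall i, a i <= b i) ->
  #|[set t : {ffun 'I_n -> 'I_Q} | [forall i, a i <= (t i)%:R / M%:R <= b i]]%SET|%:R
  <= M%:R ^+ n * \prod_(i < n) (b i - a i + M%:R^-1).
Proof.
move=> M0 ab; have M0' : 0 < M%:R :> R by rewrite ltr0n.
have -> : M%:R ^+ n = \prod_(i < n) M%:R :> R by rewrite prodr_const card_ord.
rewrite -big_split /=.
have -> : #|[set t : {ffun 'I_n -> 'I_Q} | [forall i, a i <= (t i)%:R / M%:R <= b i]]%SET|%:R
   = \prod_(i < n) \sum_(t < Q) (a i <= t%:R / M%:R <= b i)%R%:R :> R.
  rewrite bigA_distr_bigA /= -sum1_card natr_sum big_mkcond /=; apply: eq_bigr => t _.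
  rewrite inE; case: forallP => [h|h].
    by rewrite big1 // => i _; rewrite h.
  have /existsP[i Hi] : [exists i, ~~ (a i <= (t i)%:R / M%:R <= b i)].
    by rewrite -negb_forall; apply/forallP.
  by rewrite (bigD1 i) //= (negbTE Hi) mul0r.
apply: ler_prod => i _; apply/andP; split; first exact: sumr_ge0.
have := @card_interval_le (M%:R * a i) Q (M%:R * b i).
rewrite (_ : M%:R * (b i - a i + M%:R^-1) = M%:R * b i - M%:R * a i + 1); last first.
  by field; rewrite gt_eqF.
move=> h; apply: le_trans (h _); last first.
  by have := ab i; rewrite -(ler_pM2l M0'); lra.
rewrite -sum1_card natr_sum [leRHS]big_mkcond /=; apply: ler_sum => t _.
by rewrite inE ler_pdivlMr // ler_pdivrMr // ![_ * M%:R]mulrC; case: (_ && _).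
Qed.

Lemma card_fine_grid (Q M : nat) (S : {set {ffun 'I_n -> 'I_Q}}) : (0 < M)%N ->
  (#|S| * M ^ n <= #|[set t : {ffun 'I_n -> 'I_(Q * M)} |
     [exists z in S, [forall i, t i %/ M == z i]]]%SET|)%N.
Proof.
move=> M0.
have -> : (M ^ n = #|[set: {ffun 'I_n -> 'I_M}]%SET|)%N by rewrite cardsT card_ffun !card_ord.
rewrite -cardsX.
have lt (q : 'I_Q) (u : 'I_M) : (q * M + u < Q * M)%N.
  apply: (@leq_trans (q.+1 * M)); first by rewrite mulSnr ltn_add2l.
  by rewrite leq_mul2r ltn_ord orbT.
pose g (zu : {ffun 'I_n -> 'I_Q} * {ffun 'I_n -> 'I_M}) : {ffun 'I_n -> 'I_(Q * M)} :=
  [ffun i => Ordinal (lt (zu.1 i) (zu.2 i))].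
have g_inj : injective g.
  move=> [z u] [z' u'] /ffunP gE; congr pair; apply/ffunP => i; apply/val_inj.
    have := congr1 (fun t : 'I_(Q * M) => (val t %/ M)%N) (gE i); rewrite !ffunE /=.
    by rewrite !divnMDl // !divn_small // !addn0.
  have := congr1 (fun t : 'I_(Q * M) => (val t %% M)%N) (gE i); rewrite !ffunE /=.
  by rewrite !modnMDl !modn_small.
rewrite -(card_imset _ g_inj); apply: subset_leq_card; apply/fintype.subsetP => t.
case/imsetP => -[z u]; rewrite !inE /= andbT => zS ->.
apply/existsP; exists z; rewrite zS /=; apply/forallP => i.
by rewrite ffunE /= divnMDl // divn_small // addn0.
Qed.

(** Points with coordinates in multiples of 1/M are counted twice: every cube holds at least M^n of
    them, and a box at most M^n times the product of its sides enlarged by 1/M. *)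
Lemma card_le_cover (Q K : nat) (S : {set {ffun 'I_n -> 'I_Q}})
    (a b : nat -> 'I_n -> R) (M : nat) : (0 < M)%N ->
    (forall j i, a j i <= b j i) ->
    (forall z y, z \in S -> unit_cube (gridpt R z) y ->
      exists2 j, (j < K)%N & box (a j) (b j) y) ->
  #|S|%:R <= \sum_(j < K) \prod_(i < n) (b j i - a j i + M%:R^-1).
Proof.
move=> M0 ab Sab.
have M0' : 0 < M%:R :> R by rewrite ltr0n.
rewrite -(@ler_pM2l _ (M%:R ^+ n)) ?exprn_gt0 //.
rewrite -natrX -natrM mulnC.
apply: (@le_trans _ _ (\sum_(j < K) #|[set t : {ffun 'I_n -> 'I_(Q * M)} |
     [forall i, (a j i <= (t i)%:R / M%:R <= b j i)%R]]%SET|)%N%:R); last first.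
  rewrite natr_sum mulr_sumr; apply: ler_sum => j _; rewrite natrX.
  exact: card_gridpt_box.
rewrite ler_nat; apply: leq_trans (card_fine_grid S M0) _.
rewrite -sum1_card big_mkcond /=.
under [X in (_ <= X)%N]eq_bigr => j _ do rewrite -sum1_card big_mkcond /=.
rewrite exchange_big /=; apply: leq_sum => t _.
case: ifP => //; rewrite inE => /existsP[z /andP[zS /forallP tz]].
have [|j jK ty] := Sab z (fun i => (t i)%:R / M%:R) zS.
  move=> i /=; rewrite /gridpt -(eqP (tz i)) ler_pdivlMr // ler_pdivrMr //.
  rewrite -mulrSr -!natrM !ler_nat leq_divM /= ltnW //.
  by rewrite [X in (_ < X)%N]mulSnr [X in (X < _)%N](divn_eq (t i) M) ltn_add2l ltn_mod.
rewrite (bigD1 (Ordinal jK)) //= inE.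
by have -> : [forall i, a j i <= (t i)%:R / M%:R <= b j i] by apply/forallP.
Qed.

Lemma open_box (a b : 'I_n -> R) :
  @open {ptws 'I_n -> R} [set y | forall i, a i < y i < b i].
Proof.
have -> : [set y : {ptws 'I_n -> R} | forall i, a i < y i < b i] =
    \big[setI/setT]_(i < n) (@proj 'I_n (fun=> R) i @^-1` `]a i, b i[%classic).
  apply/seteqP; split => y /=.
    move=> h; elim/big_rec: _ => // i B _ By; split => //.
    by rewrite /proj /= in_itv /= h.
  move=> h i; move: h; rewrite (bigD1 i) //= => -[h _].
  by move: h; rewrite /proj /= in_itv.
elim/big_rec: _ => [|i B _ oB]; first exact: openT.
apply: openI => //; apply: open_comp; last exact: interval_open.
by move=> y _; exact: proj_continuous.
Qed.

Lemma compact_box (a b : 'I_n -> R) : @compact {ptws 'I_n -> R} (box a b).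
Proof.
have := @tychonoff 'I_n (fun=> R) (fun i => `[a i, b i]%classic)
  (fun i => @segment_compact R (a i) (b i)).
congr (compact _); apply/seteqP; split => y /= h i; have := h i; by rewrite in_itv.
Qed.

End VolumeLowerBound.

Section CardVolume.
Variables (R : realType) (n : nat).

Lemma compact_unit_cubes (Q : nat) (S : {set {ffun 'I_n -> 'I_Q}}) :
  @compact {ptws 'I_n -> R}
    (\big[setU/set0]_(z in S) unit_cube (gridpt R z)).
Proof.
apply: bigsetU_compact => z _.
exact: (@compact_box R n (gridpt R z) (fun i => gridpt R z i + 1)).
Qed.

(* Enlarging the boxes of a countable cover to open ones reduces, by
   compactness, to finitely many boxes, where fine grid points are counted. *)
Lemma card_le_vol (Q : nat) (S : {set {ffun 'I_n -> 'I_Q}}) (A : set ('I_n -> R)) :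
  (forall z, z \in S -> unit_cube (gridpt R z) `<=` A) -> (#|S|%:R%:E <= vol A)%E.
Proof.
move=> SA; apply: le_ereal_inf_tmp => s [a [b [ab [Aab ->]]]].
pose V j : R := \prod_(i < n) (b j i - a j i).
have V0 j : 0 <= V j by rewrite prodr_ge0 // => i _; rewrite subr_ge0.
apply/lee_addgt0Pr => eps eps0.
have /choice[e He] : forall j, exists e : R, 0 < e /\
    forall e', 0 <= e' <= e -> \prod_(i < n) (b j i - a j i + e') <= V j + eps / (2 ^ j.+1)%:R.
  move=> j; have p2 : 0 < eps / (2 ^ j.+1)%:R by rewrite divr_gt0 // ltr0n expn_gt0.
  have [|e e0 He] := @prod_addr_le R _ (index_enum 'I_n) (fun i => b j i - a j i) _ _ p2.
    by move=> i; rewrite subr_ge0.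
  by exists e.
(* The allowance [e j] is split in three: one third for each end of a side, one for the grid spacing
   1/M. *)
pose a' j i := a j i - e j / 3.
pose b' j i := b j i + e j / 3.
pose O j : set ('I_n -> R) := [set y | forall i, a' j i < y i < b' j i].
pose C := \big[setU/set0]_(z in S) unit_cube (gridpt R z).
have CO : C `<=` \bigcup_j O j.
  move=> y Cy; have Ay : A y.
    move: Cy; rewrite /C => Cy; apply: contrapT => nA.
    move: Cy; elim/big_rec: _ => // z B zS IH [zy|//]; exact: nA (SA z zS y zy).
  have [j _ yj] := Aab y Ay; exists j => // i; rewrite /a' /b'.
  by have [e0 _] := He j; have /andP[ya yb] := yj i; apply/andP; split; lra.
(* Finite subcover: near each point of C, all sufficiently long initial segments of the open boxes
   cover. *)
have [K CK] : exists K, forall y, C y -> exists2 j, (j < K)%N & O j y.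
  have cC : @near_covering {ptws 'I_n -> R} C.
    by rewrite -compact_near_coveringP; exact: compact_unit_cubes.
  have /= [|K _ HK] := cC nat \oo (fun K y => exists2 j, (j < K)%N & O j y) _.
    move=> y /CO[j _ yj].
    exists (O j, [set K | (j < K)%N]) => /=.
      split; last by exists j.+1.
      by apply: open_nbhs_nbhs; split => //; exact: open_box.
    by move=> [y' K] [/= y'j jK]; exists j.
  by exists K; apply: HK => /=.
have [M M0 HM] : exists2 M : nat, (0 < M)%N & forall j : 'I_K, M%:R^-1 <= e j / 3.
  have [x x0 Hx] : exists2 x : R, 0 < x & forall j : 'I_K, x <= e j / 3.
    exists (\big[Order.min/1]_(j < K) (e j / 3)); last first.
      by move=> j; exact: bigmin_le_cond.
    by apply/bigmin_gtP; split => // j _; have [e0 _] := He j; rewrite divr_gt0.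
  exists (Num.truncn x^-1).+1 => // j; apply: le_trans (Hx j).
  rewrite invf_ple ?posrE ?ltr0n // ltW //.
  by have := truncnS_gt x^-1.
have bound : #|S|%:R <= \sum_(j < K) \prod_(i < n) (b' j i - a' j i + M%:R^-1).
  apply: (@card_le_cover R n Q K S a' b') => //.
    move=> j i; rewrite /a' /b'; have [e0 _] := He j; have := ab j i; lra.
  move=> z y zS zy.
  have : C y by rewrite /C (bigD1 z) //=; left.
  move=> /CK[j jK yj]; exists j => //.
  by move=> i; have /andP[/ltW -> /ltW ->] := yj i.
apply: (@le_trans _ _ (\sum_(0 <= j < K) (V j + eps / (2 ^ j.+1)%:R)%:E)%E).
  rewrite sumEFin lee_fin big_mkord; apply: (le_trans bound).
  apply: ler_sum => j _; have [e0 He'] := He j.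
  have := He' (2 * (e j / 3) + M%:R^-1); move=> h; apply: le_trans (h _).
    by rewrite le_eqVlt; apply/orP; left; apply/eqP; apply: eq_bigr => i _; rewrite /a' /b'; ring.
  have := HM j; have : 0 <= M%:R^-1 :> R by rewrite invr_ge0.
  by move=> h1 h2; apply/andP; split; lra.
apply: le_trans (epsilon_trick xpredT (A := fun j => (V j)%:E) _ (ltW eps0)); last first.
  by move=> j; rewrite lee_fin.
apply: le_trans (nneseries_lim_ge K _); first by [].
by move=> j _ _; rewrite lee_fin addr_ge0 // divr_ge0 // ltW.
Qed.

End CardVolume.

(** * Volumes and grid point counts of balls of an abstract norm *)

Section NormBalls.
Variables (R : realType) (n' : nat).
Local Notation n := n'.+1.
Variable N : ('I_n -> R) -> R.
Hypothesis N0 : N (fun=> 0) = 0.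
Hypothesis NZ : forall (a : R) x, N (fun i => a * x i) = `|a| * N x.
Hypothesis ND : forall x y, N (fun i => x i + y i) <= N x + N y.
Hypothesis N_coord : forall x i, `|x i| <= N x.
Variable delta : R.
Hypothesis N_delta : forall x, (forall i, `|x i| <= 1) -> N x <= delta.
Implicit Types (x y : 'I_n -> R).

Definition norm_ball x (r : R) : set ('I_n -> R) := [set y | N (fun i => y i - x i) <= r].

Local Notation B := norm_ball.

Lemma normBC x y : N (fun i => x i - y i) = N (fun i => y i - x i).
Proof.
rewrite -[RHS]mul1r -(@normrN1 R) -NZ; congr N; apply/funext => i.
by rewrite mulN1r opprB.
Qed.

Lemma norm_distD x y (z : 'I_n -> R) :
  N (fun i => x i - z i) <= N (fun i => x i - y i) + N (fun i => y i - z i).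
Proof.
apply: le_trans (ND _ _); rewrite le_eqVlt; apply/orP; left; apply/eqP.
by congr N; apply/funext => i; rewrite addrA subrK.
Qed.

Lemma delta_ge1 : 1 <= delta.
Proof.
have h : N (fun=> 1) <= delta by apply: N_delta => i; rewrite normr1.
by apply: le_trans h; have := N_coord (fun=> 1) ord0; rewrite normr1.
Qed.

Lemma unit_cube_dist x y : unit_cube x y -> N (fun i => y i - x i) <= delta.
Proof.
move=> xy; apply: N_delta => i; have /andP[h1 h2] := xy i.
by rewrite ger0_norm ?subr_ge0 // lerBlDr addrC.
Qed.

Definition ball_vol : R := fine (vol (B (fun=> 0) 1)).

Local Notation V := ball_vol.

(** [fine] sends infinity to 0, so finiteness must be checked: the ball lies in the cube [-1,1]^n, a
    scaled unit box. *)
Lemma vol_ball_fin : vol (B (fun=> 0) 1) = V%:E.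
Proof.
rewrite /V fineK // ge0_fin_numE ?vol_ge0 //.
have : (vol (B (fun=> 0%R) 1%R) <= (2 ^+ n)%:E * vol [set y : 'I_n -> R | forall i, (0 <= y i <= 1)%R])%E.
  rewrite -(@vol_similarity _ _ _ 2 (fun=> -1)) //; apply: le_vol => y By i /=.
  have := N_coord (fun i => y i - 0) i; rewrite subr0 => h.
  have /ler_normlP[h1 h2] := le_trans h By.
  by apply/andP; split; lra.
move/le_lt_trans; apply.
have : (vol [set y : 'I_n -> R | forall i, (0 <= y i <= 1)%R] <=
    #|[set: {ffun 'I_n -> 'I_1}]%SET|%:R%:E)%E.
  apply: vol_le_card => // y yA; exists [ffun=> ord0]; first by rewrite inE.
  by move=> i; rewrite /gridpt ffunE add0r.
move/(lee_wpmul2l (_ : (0%E <= (2 ^+ n)%:E)%E)) => /(_ ltac:(by rewrite lee_fin exprn_ge0)).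
by move/le_lt_trans; apply; rewrite -EFinM ltry.
Qed.

Lemma vol_ball x (r : R) : 0 < r -> vol (B x r) = (r ^+ n * V)%:E.
Proof.
move=> r0; rewrite EFinM -vol_ball_fin -(vol_similarity _ x r0); congr vol.
apply/seteqP; split => y; rewrite /B /=;
  rewrite (_ : (fun i => (y i - x i) / r - 0) = (fun i => r^-1 * (y i - x i)));
  rewrite ?NZ ?ger0_norm ?invr_ge0 ?(ltW r0) // ?[r^-1 * _]mulrC ?ler_pdivrMr ?mul1r //.
  by apply/funext => i; rewrite subr0 mulrC.
by apply/funext => i; rewrite subr0 mulrC.
Qed.

Lemma ball_vol_ge0 : 0 <= V.
Proof. by rewrite fine_ge0 // vol_ge0. Qed.

Definition grid_ball (Q : nat) x (r : R) : {set {ffun 'I_n -> 'I_Q}} :=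
  [set z | N (fun i => gridpt R z i - x i) <= r]%SET.

Lemma grid_ball_cube_sub Q x r z : z \in grid_ball Q x r ->
  unit_cube (gridpt R z) `<=` B x (r + delta).
Proof.
rewrite inE => zx y zy; rewrite /B /=.
apply: le_trans (norm_distD y (gridpt R z) x) _.
by rewrite addrC lerD // unit_cube_dist.
Qed.

Lemma card_grid_ball_le Q x (r : R) : 0 <= r ->
  #|grid_ball Q x r|%:R <= V * (r + delta) ^+ n.
Proof.
move=> r0; have d1 := delta_ge1.
rewrite mulrC -lee_fin -(vol_ball x); last by lra.
by apply: card_le_vol => z; exact: grid_ball_cube_sub.
Qed.

(** Rounding coordinates down moves a point by at most delta, so the cubes at the counted points
    cover the ball of radius r - delta; the last two hypotheses keep the ball inside the finite
    grid. *)
Lemma card_grid_ball_ge Q x (r : R) : delta < r ->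
    (forall i, 0 <= x i - r) -> (forall i, x i + r < Q%:R) ->
  V * (r - delta) ^+ n <= #|grid_ball Q x r|%:R.
Proof.
move=> dr xr xQ; have d1 := delta_ge1.
rewrite mulrC -lee_fin -(vol_ball x); last by lra.
apply: vol_le_card => // y By.
have yi i : `|y i - x i| <= r - delta by apply: le_trans (N_coord _ i) By.
have y0 i : 0 <= y i by have := xr i; have /ler_normlP[] := yi i; lra.
have yQ i : y i < Q%:R by have := xQ i; have /ler_normlP[] := yi i; lra.
have tQ i : (Num.truncn (y i) < Q)%N by rewrite -(ltr_nat R) (le_lt_trans _ (yQ i)) // truncn_le.
have cube : unit_cube (gridpt R [ffun i => Ordinal (tQ i)]) y.
  move=> i; rewrite /gridpt ffunE /= truncn_le.
  by rewrite y0 natr1 (ltW (truncnS_gt (y i))).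
exists [ffun i => Ordinal (tQ i)] => //.
rewrite inE; apply: le_trans (norm_distD _ y x) _.
by rewrite normBC; have := unit_cube_dist cube; move: By; rewrite /B /= => h1 h2; lra.
Qed.

Lemma ball_vol_delta : 1 <= V * delta ^+ n.
Proof.
have d1 := delta_ge1.
rewrite mulrC -lee_fin -(vol_ball (fun=> 0)); last by lra.
have <- : #|[set: {ffun 'I_n -> 'I_1}]%SET|%:R = 1 :> R by rewrite cardsT card_ffun !card_ord exp1n.
apply: card_le_vol => z zS y zy; rewrite /B /=.
have zE : gridpt R z = (fun=> 0) by apply/funext => i; rewrite /gridpt ord1.
by have := unit_cube_dist zy; rewrite zE.
Qed.

Lemma ball_vol_gt0 : 0 < V.
Proof.
rewrite lt_def ball_vol_ge0 andbT; apply: contraTneq ball_vol_delta => ->.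
by rewrite mul0r -ltNge ltr01.
Qed.

End NormBalls.

(** * Packings from independent sets of grid points *)

Section NormPacking.
Variables (R : realType) (n' : nat).
Local Notation n := n'.+1.
Variable N : ('I_n -> R) -> R.
Hypothesis N0 : N (fun=> 0) = 0.
Hypothesis NZ : forall (a : R) x, N (fun i => a * x i) = `|a| * N x.
Hypothesis ND : forall x y, N (fun i => x i + y i) <= N x + N y.
Hypothesis N_coord : forall x i, `|x i| <= N x.
Variable delta : R.
Hypothesis N_delta : forall x, (forall i, `|x i| <= 1) -> N x <= delta.
Variable eta : R.
Hypothesis eta_bound : 0 < eta <= 2^-1.
Hypothesis lens : forall (r : R) (u : 'I_n -> R), 0 < r -> N u <= r ->
  exists c : 'I_n -> R, forall w : 'I_n -> R, N w <= N u ->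
    N (fun i => w i - u i) <= r -> N (fun i => w i - c i) <= (1 - eta) * r.

Local Notation B := (norm_ball N).
Local Notation V := (ball_vol N).
Let V_gt0 : 0 < V := ball_vol_gt0 NZ N_coord N_delta.
Let d1 : 1 <= delta := delta_ge1 N_coord N_delta.

Section Grid.
Variables (q : nat) (rho L : R).
Local Notation Q := (q.*2.+1).
Local Notation pt := (@gridpt R n Q).
Local Notation c := (fun _ : 'I_n => q%:R : R).
Hypothesis rho_gt : 2 * delta < rho.
Hypothesis q_gt : rho + delta < q%:R.

Let Q_E : Q%:R = 2 * q%:R + 1 :> R.
Proof. by rewrite -natr1 -muln2 natrM mulrC. Qed.

Lemma grid_packing : delta <= eta * rho -> 0 <= L ->
    expR (6 * L) * 4 * (1 - eta / 2) ^+ n <= 1 ->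
  exists I : {set {ffun 'I_n -> 'I_Q}},
  [/\ forall z, z \in I -> N (fun i => pt z i - q%:R) <= q%:R - rho,
      forall z w, z \in I -> w \in I -> z != w -> 2 * rho < N (fun i => pt z i - pt w i) &
      L * (q%:R - rho - delta) ^+ n <= 2 * (2 * rho + delta) ^+ n * #|I|%:R].
Proof.
move=> d_rho L0 HL; have /andP[eta0 eta1] := eta_bound.
have d1' := d1; have rg := rho_gt; have qg := q_gt.
have rho0 : 0 < rho by lra.
(* Centres stay within q - rho of the middle of the grid, so that their rho-balls lie in the ball of
   radius q. *)
pose T := {z : {ffun 'I_n -> 'I_Q} | z \in grid_ball N Q c (q%:R - rho)}.
pose dist (z w : T) := N (fun i => pt (val w) i - pt (val z) i).
have distC z w : dist z w = dist w z by exact: (normBC NZ).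
pose e : rel T := fun z w => (z != w) && (dist z w <= 2 * rho).
have e_sym : symmetric e by move=> z w; rewrite /e eq_sym distC.
have e_irr : irreflexive e by move=> z; rewrite /e eqxx.
have cardT (S : {set T}) (S' : {set {ffun 'I_n -> 'I_Q}}) :
    (forall z, z \in S -> val z \in S') -> #|S|%:R <= #|S'|%:R :> R.
  move=> SS'; rewrite ler_nat -(card_imset S val_inj); apply: subset_leq_card.
  by apply/fintype.subsetP => _ /imsetP[z zS ->]; exact: SS'.
pose D := V * (2 * rho + delta) ^+ n.
pose K := V * ((1 - eta) * (2 * rho) + delta) ^+ n.
have er0 : 0 <= (1 - eta) * (2 * rho) by rewrite mulr_ge0; lra.
have K1 : 1 <= K.
  apply: le_trans (ball_vol_delta NZ N_coord N_delta) _.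
  rewrite ler_pM2l // lerXn2r ?nnegrE; lra.
have HD v : #|[set u | e v u]%SET|%:R <= D.
  apply: le_trans (card_grid_ball_le NZ ND N_coord N_delta Q (pt (val v)) _); last by lra.
  by apply: cardT => z; rewrite !inE => /andP[_].
have HK v u : e v u -> #|[set w in closed_nbhd e u | dist v w <= dist v u]%SET|%:R <= K.
  move=> /andP[_ vu]; have r0 : 0 < 2 * rho by lra.
  have [c0 Hc0] := lens r0 vu.
  apply: le_trans (card_grid_ball_le NZ ND N_coord N_delta Q (fun i => pt (val v) i + c0 i) er0).
  apply: cardT => w; rewrite !inE => /andP[uw vw].
  rewrite (_ : (fun i => _) = (fun i => pt (val w) i - pt (val v) i - c0 i)); last first.
    by apply/funext => i; rewrite opprD addrA.
  apply: Hc0 => //.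
  rewrite (_ : (fun i => _) = (fun i => pt (val w) i - pt (val u) i)); last first.
    by apply/funext => i; ring.
  case/orP: uw => [/eqP ->|/andP[_]//].
  have -> : N (fun i => pt (val u) i - pt (val u) i) = 0.
    by rewrite -[RHS]N0; congr N; apply/funext => i; rewrite subrr.
  exact: ltW.
have HE : expR (6 * L) <= D / (4 * K).
  rewrite ler_pdivlMr; last by lra.
  have rn0 : 0 <= (2 * rho) ^+ n by rewrite exprn_ge0 //; lra.
  (* As delta <= eta rho, the grid error costs only half of the gain: (1 - eta) 2 rho + delta <= (1
     - eta/2) 2 rho. *)
  have h1 : K <= V * ((1 - eta / 2) ^+ n * (2 * rho) ^+ n).
    rewrite ler_pM2l // -exprMn lerXn2r ?nnegrE //; first lra.
      by rewrite mulr_ge0; lra.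
    lra.
  have h2 : V * (2 * rho) ^+ n <= D by rewrite ler_pM2l // lerXn2r ?nnegrE; lra.
  apply: le_trans h2; rewrite mulrA.
  apply: (@le_trans _ _ (expR (6 * L) * 4 * (V * ((1 - eta / 2) ^+ n * (2 * rho) ^+ n)))).
    by rewrite ler_wpM2l // mulr_ge0 // expR_ge0.
  rewrite [leLHS](_ : _ = V * (2 * rho) ^+ n * (expR (6 * L) * 4 * (1 - eta / 2) ^+ n)); last by ring.
  by rewrite -[leRHS]mulr1 ler_wpM2l // mulr_ge0 // ltW.
have [I iI LI] := large_independent_set e_sym e_irr L0 K1 HD HK HE.
exists [set val z | z in I]%SET; split.
- by move=> _ /imsetP[z _ ->]; have := valP z; rewrite inE.
- move=> _ _ /imsetP[z zI ->] /imsetP[w wI ->] zw.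
  have := independentP _ _ iI w z wI zI; rewrite /e (_ : w != z) /=.
    by rewrite -ltNge.
  by apply: contraNneq zw => ->.
rewrite card_imset; last exact: val_inj.
rewrite -(ler_pM2l V_gt0).
have -> : V * (2 * (2 * rho + delta) ^+ n * #|I|%:R) = 2 * D * #|I|%:R by rewrite /D; ring.
apply: le_trans LI.
have -> : #|{: T}| = #|grid_ball N Q c (q%:R - rho)|.
  by rewrite card_sig; apply: eq_card => z; rewrite inE.
rewrite mulrCA ler_wpM2l //.
apply: (card_grid_ball_ge NZ ND N_coord N_delta); first by lra.
  by move=> i; lra.
by move=> i; have QE := Q_E; lra.
Qed.

(** The grid points within rho - delta of the centres form disjoint finite sets, and their unit
    cubes lie in the union of rho-balls. One delta is lost for the cubes and one for the count. *)
Lemma vol_grid_packing (I : {set {ffun 'I_n -> 'I_Q}}) :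
    (forall z, z \in I -> N (fun i => pt z i - q%:R) <= q%:R - rho) ->
    (forall z w, z \in I -> w \in I -> z != w -> 2 * rho < N (fun i => pt z i - pt w i)) ->
  ((#|I|%:R * (V * (rho - 2 * delta) ^+ n))%:E <=
    vol (B c q%:R `&` \bigcup_(z in [set` I]) B (pt z) rho))%E.
Proof.
move=> Iq Id; have d1' := d1; have rg := rho_gt; have qg := q_gt.
pose G z := grid_ball N Q (pt z) (rho - delta).
pose S := [set t | [exists z in I, t \in G z]]%SET.
apply: (@le_trans _ _ #|S|%:R%:E); last first.
  apply: card_le_vol => t; rewrite inE => /existsP[z /andP[zI tz]] y yt.
  have yz : N (fun i => y i - pt z i) <= rho.
    by have := grid_ball_cube_sub ND N_delta tz yt; rewrite /norm_ball /= subrK.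
  split; last by exists z.
  rewrite /norm_ball /=; apply: le_trans (norm_distD ND y (pt z) c) _.
  by have := Iq z zI; lra.
rewrite lee_fin.
have GS : (\sum_(z in I) #|G z| <= #|S|)%N.
  under eq_bigr => z _ do rewrite -sum1_card big_mkcond /=.
  rewrite exchange_big -sum1_card [leqRHS]big_mkcond /=; apply: leq_sum => t _.
  rewrite inE; case: existsP => [[z /andP[zI tz]]|h].
    rewrite (bigD1 z) //= tz big1 // => w /andP[wI wz].
    case: ifP => // tw; have := Id w z wI zI wz.
    have := norm_distD ND (pt w) (pt t) (pt z).
    move: tz tw; rewrite !inE (normBC NZ (pt t) (pt w)) => h1 h2 h3 h4; exfalso; lra.
  rewrite big1 // => z zI; case: ifP => // tz.
  by exfalso; apply: h; exists z; rewrite zI.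
apply: (@le_trans _ _ (\sum_(z in I) #|G z|)%N%:R); last by rewrite ler_nat.
rewrite natr_sum mulr_natl -sumr_const; apply: ler_sum => z zI.
rewrite (_ : rho - 2 * delta = rho - delta - delta); last by ring.
have zc i : `|pt z i - q%:R| <= q%:R - rho.
  exact: le_trans (N_coord (fun i => pt z i - q%:R) i) (Iq z zI).
apply: (card_grid_ball_ge NZ ND N_coord N_delta); first by lra.
  by move=> i; have /ler_normlP[] := zc i; lra.
by move=> i; have QE := Q_E; have /ler_normlP[] := zc i; lra.
Qed.

(** Translating the grid centre to the origin and scaling by rad/rho preserves the density. *)
Lemma packing_of_grid (rad : R) (I : {set {ffun 'I_n -> 'I_Q}}) : 0 < rad ->
    (forall z, z \in I -> N (fun i => pt z i - q%:R) <= q%:R - rho) ->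
    (forall z w, z \in I -> w \in I -> z != w -> 2 * rho < N (fun i => pt z i - pt w i)) ->
  let Rr := rad / rho * q%:R in
  exists2 P : set ('I_n -> R),
    forall x y, P x -> P y -> x <> y -> 2 * rad < N (fun i => x i - y i) &
    #|I|%:R * (rho - 2 * delta) ^+ n / q%:R ^+ n <=
    fine (vol (B (fun=> 0) Rr `&` \bigcup_(x in P) B x rad)) / fine (vol (B (fun=> 0) Rr)).
Proof.
move=> rad0 Iq Id; have d1' := d1; have rg := rho_gt; have qg := q_gt.
have rho0 : 0 < rho by lra.
have q0 : 0 < q%:R :> R by lra.
pose s := rad / rho; have s0 : 0 < s by rewrite divr_gt0.
move=> Rr; have Rr0 : 0 < Rr by rewrite mulr_gt0.
have sE : rad = s * rho by rewrite divfK // gt_eqF.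
exists [set x | exists2 z, z \in I & x = (fun i => s * (pt z i - q%:R))].
  move=> _ _ [z zI ->] [w wI ->] zw.
  rewrite (_ : (fun i => _) = (fun i => s * (pt z i - pt w i))); last first.
    by apply/funext => i; ring.
  rewrite NZ gtr0_norm // sE mulrCA ltr_pM2l // Id //.
  by apply: contra_notN zw => /eqP ->.
set X := _ `&` _.
have Xfin : vol X \is a fin_num.
  rewrite ge0_fin_numE ?vol_ge0 //.
  have : (vol X <= vol (B (fun=> 0%R) Rr))%E by apply: le_vol; exact: subIsetl.
  by rewrite (vol_ball NZ N_coord) // => /le_lt_trans; apply; rewrite ltry.
have HX : (((s ^+ n) * (#|I|%:R * (V * (rho - 2 * delta) ^+ n)))%:E <= vol X)%E.
  rewrite EFinM.
  apply: le_trans (lee_wpmul2l _ (vol_grid_packing Iq Id)) _.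
    by rewrite lee_fin exprn_ge0 // ltW.
  rewrite -(vol_similarity _ (fun=> - (s * q%:R)) s0); apply: le_vol => y [yq [z zI yz]].
  have sc (t : 'I_n -> R) (r : R) : N (fun i => s^-1 * t i) <= r -> N t <= s * r.
    by rewrite NZ gtr0_norm ?invr_gt0 // ler_pdivrMl.
  have sn : s != 0 by rewrite gt_eqF.
  split.
    rewrite /norm_ball /= /Rr; apply: sc; move: yq; rewrite /norm_ball /=.
    rewrite (_ : (fun i => _) = (fun i => s^-1 * (y i - 0))) //.
    by apply/funext => i; field.
  exists (fun i => s * (pt z i - q%:R)); first by exists z.
  rewrite /norm_ball /= sE; apply: sc; move: yz; rewrite /norm_ball /=.
  rewrite (_ : (fun i => _) = (fun i => s^-1 * (y i - s * (pt z i - q%:R)))) //.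
  by apply/funext => i; field.
rewrite (vol_ball NZ N_coord (fun=> 0) Rr0) /=.
have RV : 0 < Rr ^+ n * V by rewrite mulr_gt0 // exprn_gt0.
rewrite ler_pdivlMr //.
rewrite -lee_fin (fineK Xfin); apply: le_trans HX; rewrite lee_fin.
rewrite /Rr -/s exprMn le_eqVlt; apply/orP; left; apply/eqP; field.
by rewrite expf_neq0 // gt_eqF.
Qed.

End Grid.

Lemma exists_dense_packing (rad M : R) : 0 < rad -> 8 <= n%:R * eta ->
  exists2 Rr : R, M <= Rr & exists2 P : set ('I_n -> R),
    forall x y, P x -> P y -> x <> y -> 2 * rad < N (fun i => x i - y i) &
    n%:R * eta / 192 / 2 ^+ n <=
    fine (vol (B (fun=> 0) Rr `&` \bigcup_(x in P) B x rad)) / fine (vol (B (fun=> 0) Rr)).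
Proof.
move=> rad0 n_eta; have /andP[eta0 eta1] := eta_bound; have d1' := d1.
have n1 : 1 <= n%:R :> R by rewrite ler1n.
have n0 : 0 < n%:R :> R by lra.
(* The term 5 n keeps the n-th powers below within a factor 2; the term 1/eta yields delta <= eta
   rho. *)
pose rho := delta * (5 * n%:R + eta^-1).
have ei : 0 < eta^-1 by rewrite invr_gt0.
have rho5 : 5 * n%:R * delta <= rho by rewrite /rho mulrC ler_pM2l; lra.
have n5 : 5 * delta <= 5 * n%:R * delta by rewrite ler_wpM2r; lra.
have rho_gt : 2 * delta < rho by lra.
have rho0 : 0 < rho by lra.
have d_rho : delta <= eta * rho.
  rewrite /rho (_ : eta * _ = delta * (5 * n%:R * eta) + delta * (eta * eta^-1)); last by ring.
  by rewrite divff ?gt_eqF // mulr1 lerDr mulr_ge0 //; [lra|rewrite mulr_ge0; lra].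
pose s := rad / rho; have s0 : 0 < s by rewrite divr_gt0.
(* The first bound makes the boundary layer negligible up to a factor 2, the second makes the radius
   at least M. *)
pose q := (Num.truncn (Num.max (2 * n%:R * (rho + delta)) (M / s))).+1.
have /ltW := truncnS_gt (Num.max (2 * n%:R * (rho + delta)) (M / s)).
rewrite -/q ge_max => /andP[q1 q2].
have q3 : 2 * (rho + delta) <= 2 * n%:R * (rho + delta) by rewrite ler_wpM2r; lra.
have q_gt : rho + delta < q%:R by lra.
(* Then 6 L = n eta/4, half of the decay n eta/2 of (1 - eta/2)^n; the remaining n eta/4 >= 2
   absorbs the factor 4 <= expR 2. *)
pose L : R := n%:R * eta / 24.
have L0 : 0 <= L by rewrite /L; lra.
have HL : expR (6 * L) * 4 * (1 - eta / 2) ^+ n <= 1.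
  have h4 : 4 <= expR 2 :> R.
    rewrite (_ : 2 = 1 + 1 :> R) // expRD.
    have : 2 <= expR 1 :> R by have := expR_ge1Dx (1 : R); lra.
    move=> h; rewrite (_ : 4 = 2 * 2 :> R); last by ring.
    by rewrite ler_pM.
  have hn : (1 - eta / 2) ^+ n <= expR (- (n%:R * eta / 2)).
    rewrite (_ : - (n%:R * eta / 2) = n%:R * (- (eta / 2))); last by ring.
    rewrite expRM_natl lerXn2r ?nnegrE ?expR_ge0 //; first by lra.
    by have := expR_ge1Dx (- (eta / 2)); lra.
  apply: (@le_trans _ _ (expR (6 * L) * expR 2 * expR (- (n%:R * eta / 2)))).
    rewrite ler_pM ?mulr_ge0 ?expR_ge0 ?exprn_ge0 //; first by lra.
    by rewrite ler_wpM2l ?expR_ge0.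
  by rewrite -!expRD -[leRHS](@expR0 R) ler_expR /L; lra.
have [I [Iq Id LI]] := grid_packing rho_gt q_gt d_rho L0 HL.
have [P HP HD] := packing_of_grid rho_gt q_gt rad0 Iq Id.
exists (rad / rho * q%:R); first by rewrite mulrC -ler_pdivrMr.
exists P => //; apply: le_trans HD.
have bern (m : nat) (x : R) : 0 <= x <= 1 -> 1 - m%:R * x <= (1 - x) ^+ m.
  move=> /andP[x0 x1]; elim: m => [|m IH]; first by rewrite mul0r subr0 expr0.
  rewrite exprS; apply: (@le_trans _ _ ((1 - x) * (1 - m%:R * x))).
    rewrite -natr1; have : 0 <= m%:R * x * x by rewrite !mulr_ge0.
    lra.
  by rewrite ler_wpM2l //; lra.
have n2 : 0 < 2 * n%:R :> R by lra.
(* Relative errors of 1/(2 n) cost at most a factor 2 in the n-th power, by Bernoulli's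
   inequality. *)
pose ni : R := (2 * n%:R)^-1.
pose b : R := 1 - ni.
have i1 : 0 <= ni <= 1.
  by apply/andP; split; [apply: ltW; rewrite invr_gt0|rewrite invf_le1 //; lra].
have bn : 2^-1 <= b ^+ n.
  apply: le_trans (bern n _ i1).
  by rewrite /ni invfM mulrCA divff ?gt_eqF // mulr1; lra.
have b0 : 0 <= b by rewrite /b; lra.
have bq : b * q%:R <= q%:R - rho - delta.
  have : rho + delta <= ni * q%:R by rewrite /ni [leRHS]mulrC ler_pdivlMr // mulrC.
  by rewrite /b; lra.
have brho : b * (rho + delta / 2) <= rho - 2 * delta.
  have : 5 / 2 * delta <= ni * rho by rewrite /ni [leRHS]mulrC ler_pdivlMr //; lra.
  have : 0 <= ni * delta by case/andP: i1 => i0 _; rewrite mulr_ge0 //; lra.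
  by rewrite /b; lra.
have qn0 : 0 < q%:R ^+ n :> R by rewrite exprn_gt0 //; lra.
have P1 : 2^-1 * q%:R ^+ n <= (q%:R - rho - delta) ^+ n.
  apply: (@le_trans _ _ ((b * q%:R) ^+ n)).
    by rewrite exprMn ler_wpM2r // ltW.
  by rewrite lerXn2r ?nnegrE //; [rewrite mulr_ge0|lra].
have P2 : 2^-1 * (rho + delta / 2) ^+ n <= (rho - 2 * delta) ^+ n.
  apply: (@le_trans _ _ ((b * (rho + delta / 2)) ^+ n)).
    by rewrite exprMn ler_wpM2r // exprn_ge0 //; lra.
  by rewrite lerXn2r ?nnegrE //; [rewrite mulr_ge0 //; lra|lra].
have E2 : (2 * rho + delta) ^+ n = 2 ^+ n * (rho + delta / 2) ^+ n.
  by rewrite -exprMn; congr (_ ^+ _); field.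
rewrite ler_pdivlMr // mulrAC ler_pdivrMr ?exprn_gt0 //.
have S1 : L * (2^-1 * q%:R ^+ n) <= L * (q%:R - rho - delta) ^+ n by rewrite ler_wpM2l.
have S2 : 2 * (2 ^+ n * (2^-1 * (rho + delta / 2) ^+ n)) * #|I|%:R <=
    2 * (2 ^+ n * (rho - 2 * delta) ^+ n) * #|I|%:R.
  by rewrite ler_wpM2r // ler_wpM2l // ler_wpM2l // exprn_ge0.
rewrite E2 in LI.
(* The 8 collects the factor 2 of [LI] and the two halves from [P1] and [P2]. *)
have -> : n%:R * eta / 192 = L / 8 by rewrite /L; field.
move: LI S1 S2; move: (2 ^+ n) (q%:R ^+ n) ((q%:R - rho - delta) ^+ n).
by move: ((rho + delta / 2) ^+ n) ((rho - 2 * delta) ^+ n) => ? ? ? ? ?; lra.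
Qed.

End NormPacking.

(** * From packings to the density [Delta] *)

Section DeltaBounds.
Variable R : realType.

(** For an upper limit, one good radius beyond each M is enough. *)
Lemma Delta_ge (p : R) (n m : nat) (k : nat -> nat) (d : R) :
    (forall M : R, exists2 Rr, M <= Rr & exists2 P, is_packing p m k P &
      d <= fine (vol (superball p m k (@origin R n) Rr `&`
                      \bigcup_(x in P) superball p m k x (Defs.rad p n m k)))
           / fine (vol (superball p m k (@origin R n) Rr))) ->
  (d%:E <= Delta p n m k)%E.
Proof.
move=> H; apply: le_ereal_inf_tmp => _ [M ->].
have [Rr MRr [P HP dP]] := H M.
apply: (@le_trans _ _ (local_density p n m k Rr)); last first.
  by apply: ereal_sup_ubound; exists Rr.
apply: le_trans (ereal_sup_ubound _); last by exists P; split; [exact: HP|].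
by rewrite lee_fin.
Qed.

Lemma Delta_ge0 (p : R) (n m : nat) (k : nat -> nat) : (0 <= Delta p n m k)%E.
Proof.
apply: Delta_ge => M; exists M => //; exists set0 => //.
by rewrite divr_ge0 // fine_ge0 // vol_ge0.
Qed.

(** The set of radii is bounded by max(1, 1/V), so its [sup] is genuine, and it contains min(1, 1/V)
    > 0. *)
Lemma rad_gt0 (p : R) (n' m : nat) (k : nat -> nat) : 1 < p ->
  admissible n'.+1 m k -> 0 < Defs.rad p n'.+1 m k.
Proof.
move=> p1 adm; set n := n'.+1.
have NZ := @supnormZ R p n m k p1.
have N_coord x i := @ler_coord_supnorm R p n m k p1 x i adm.
have N_delta (x : 'I_n -> R) : (forall i, `|x i| <= 1) ->
    supnorm p m k x <= supnorm p m k (fun _ : 'I_n => 1 : R).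
  by move=> x1; apply: (supnorm_mono m k p1) => i; rewrite normr1 x1.
have V0 := ball_vol_gt0 NZ N_coord N_delta.
set V := ball_vol _ in V0.
have volE (r : R) : 0 < r -> vol (superball p m k (@origin R n) r) = (r ^+ n * V)%:E.
  by move=> r0; rewrite -(vol_ball NZ N_coord (fun=> 0) r0).
have Vi0 : 0 < V^-1 by rewrite invr_gt0.
pose r := Num.min 1 V^-1.
have r0 : 0 < r by rewrite lt_min ltr01.
have ub : has_ubound [set r : R | 0 <= r /\ (vol (superball p m k (@origin R n) r) <= 1)%E].
  exists (Num.max 1 V^-1) => t [t0 tV]; rewrite le_max.
  have [//|t1] := leP t 1; rewrite -(mul1r V^-1) ler_pdivlMr //=.
  move: tV; rewrite volE ?(lt_trans ltr01) // lee_fin; apply: le_trans.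
  by rewrite ler_wpM2r ?(ltW V0) // /n exprS ler_peMr // exprn_ege1 // ltW.
apply: (lt_le_trans r0); apply: (ub_le_sup ub).
split; first exact: ltW.
rewrite volE // lee_fin -ler_pdivlMr // mul1r; apply: (@le_trans _ _ r).
  by rewrite /n exprS ler_piMr ?(ltW r0) // exprn_ile1 ?(ltW r0) // ge_min lexx.
by rewrite ge_min lexx orbT.
Qed.

(** Strict separation makes even the closed superballs disjoint, by the triangle inequality. *)
Lemma is_packing_of_dist (p : R) (n m : nat) (k : nat -> nat) (P : set ('I_n -> R)) :
    1 < p ->
    (forall x y, P x -> P y -> x <> y ->
      2 * Defs.rad p n m k < supnorm p m k (fun i => x i - y i)) ->
  is_packing p m k P.
Proof.
move=> p1 HP x y Px Py xy; apply/seteqP; split => // z [].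
move=> /interior_subset zx /interior_subset zy.
have := lt_le_trans (HP x y Px Py xy) (ler_dist_supnormD m k p1 x z y).
rewrite (supnormBC m k p1 x z) => /lt_le_trans/(_ (lerD zx zy)).
by rewrite mulr_natl mulr2n ltxx.
Qed.

End DeltaBounds.

Theorem theorem2 (R : realType) (p : R) (hp : 1 < p <= 2) :
  exists c : R, 0 < c < 2 /\
  exists eta : nat -> R, eta @ \oo --> (0 : R) /\
  forall (n m : nat) (k : nat -> nat), admissible n m k ->
    (((1 + eta n) * (ln (2 / c) * n%:R / 2 ^+ n))%:E <= Delta p n m k)%E.
Proof.
have p1 : 1 < p by case/andP: hp.
have [e e_bound lens] := lens_in_smaller_ball hp; have /andP[e0 e1] := e_bound.
have e192 : 0 < e / 192 by rewrite divr_gt0.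
(* Chosen so that ln (2 / c) = e/192, the constant of [exists_dense_packing]. *)
exists (2 * expR (- (e / 192))); split.
  by rewrite mulr_gt0 ?expR_gt0 //= -[ltRHS]mulr1 ltr_pM2l // expR_lt1 oppr_lt0.
have -> : ln (2 / (2 * expR (- (e / 192)))) = e / 192.
  by rewrite invfM mulrA divff // mul1r expRN invrK expRK.
(* The value -1 makes the bound trivial in the finitely many dimensions below the threshold n e >=
   8, including n = 0. *)
exists (fun n => if n%:R * e < 8 then -1 else 0); split.
  apply: (@cvg_near_cst _ _ _ _ _ _).
  exists (Num.truncn (8 / e)).+1 => //= n /= hn; rewrite ifF //; apply/negbTE.
  rewrite -leNgt -ler_pdivrMr //; apply: le_trans (ltW (truncnS_gt _)) _.
  by rewrite ler_nat.
move=> n m k adm; case: ifPn => [_|]; first by rewrite subrr mul0r Delta_ge0.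
rewrite -leNgt addr0 mul1r (_ : e / 192 * n%:R = n%:R * e / 192); last by ring.
case: n adm => [|n'] adm ne; first by exfalso; move: ne; rewrite mul0r; lra.
apply: Delta_ge => M.
have [|Rr MRr [P HP dP]] := exists_dense_packing (supnorm0 _ _ _ p1) (supnormZ m k p1)
  (ler_supnormD m k p1) (fun x i => ler_coord_supnorm p1 x i adm)
  (delta := supnorm p m k (fun _ : 'I_n'.+1 => 1)) _ e_bound (lens n'.+1 m k) M (rad_gt0 p1 adm) ne.
  by move=> x x1; apply: (supnorm_mono m k p1) => i; rewrite normr1 x1.
exists Rr => //; exists P => //; exact: is_packing_of_dist.
Qed.
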